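(* Let $p$ be a prime number. Let $E=D[x,y;\sigma,\tau,b,\rho]$ be a diskew polynomial ring such that $\rho$ is a unit in $D$, $\nu=\tau\sigma$ is an epimorphism (a surjective endomorphism of $D$) and $D$ is an $\mathbb{F}_p$-algebra. The following statements are equivalent. 1. The ring $E$ is a simple ring. 2. (a) The endomorphisms $\sigma$ and $\tau$ of $D$ are automorphisms; (b) the ring $D$ is a $\sigma$-simple ring; (c) for each natural number $n\ge 0$ there is no element $p'=h^{p^n}+\sum_{i=0}^{n-1}\alpha_ih^{p^i}+\alpha$ (in $\mathcal{D}=D[h;\nu]$), where $\alpha,\alpha_i\in D$, such that (i) for all $d\in D$, $p'd=\nu^{p^n}(d)p'$, i.e. $\alpha d=\nu^{p^n}(d)\alpha$ and $\alpha_id=\nu^{p^n-p^i}(d)\alpha_i$ for $i=0,1,\ldots,n-1$, (ii) $\sigma(p')=\rho^\nu_{p^n}p'$, (iii) $[h,p']=0$, i.e. $\nu(\alpha)=\alpha$ and $\nu(\alpha_i)=\alpha_i$ for $i=0,1,\ldots,n-1$; and (d) the elements $b_i\in D$, where $i\ge1$, are units in $D$. (In particular, $b=b_1\in D$ is a unit.) 3. (a) The endomorphisms $\sigma$ and $\tau$ of $D$ are automorphisms; (b) the ring $D$ is a $\sigma$-simple ring; (c) there is no element $\alpha\in D$ such that $\rho\alpha-\sigma(\alpha)=b$, $\nu(\alpha)=\alpha$ and $\alpha d=\nu(d)\alpha$ for all elements $d\in D$, and for each natural number $n\ge 1$ there are no elements $\alpha,\alpha_0,\ldots,\alpha_{n-1}\in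 D$ such that (i) for all $d\in D$, $\alpha d=\nu^{p^n}(d)\alpha$ and $\alpha_id=\nu^{p^n-p^i}(d)\alpha_i$ for $i=0,1,\ldots,n-1$, (ii) $\sigma(\alpha_i)=\rho^\nu_{p^n-p^i}\alpha_i$ for $i=0,1,\ldots,n-1$, and $\rho^\nu_{p^n}\alpha-\sigma(\alpha)=b^{p^n}+\sum_{i=0}^{n-1}\sigma(\alpha_i)b^{p^i}$, (iii) $\nu(\alpha)=\alpha$ and $\nu(\alpha_i)=\alpha_i$ for $i=0,1,\ldots,n-1$; and (d) the elements $b_i\in D$, where $i\ge1$, are units in $D$. (In particular, $b=b_1\in D$ is a unit.)
   Context: Diskew polynomial ring: let $D$ be a ring, $\sigma,\tau$ ring endomorphisms of $D$, and $\rho,b\in D$ such that $\sigma\tau(d)\rho=\rho\,\tau\sigma(d)$ and $\sigma\tau(d)b=bd$ for all $d\in D$. Then $E=D[x,y;\sigma,\tau,b,\rho]$ is the ring generated by $D$, $x$ and $y$ subject to the defining relations $xd=\sigma(d)x$, $yd=\tau(d)y$ for all $d\in D$, and $xy-\rho yx=b$. Products of endomorphisms are compositions. When $\rho$ is a unit, the subring $\mathcal{D}$ of $E$ generated by $D$ and $h=yx$ is the skew polynomial ring $D[h;\nu]$, $\nu=\tau\sigma$ (so $hd=\nu(d)h$ for $d\in D$), and $\sigma$ extends to a ring endomorphism of $\mathcal{D}$ by $\sigma(h)=\rho h+b$. For $i\ge1$: $\rho_i^\nu:=\rho\,\nu(\rho)\cdots\nu^{i-1}(\rho)$; $a_i:=\sigma^{i-1}(\rho)\cdots\sigma(\rho)\rho$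 and $b_i:=\sum_{j=1}^{i-1}\sigma^j(a_{i-j})\sigma^{j-1}(b)+\sigma^{i-1}(b)$ (equivalently, $\sigma^i(h)=a_ih+b_i$). $D$ is $\sigma$-simple if $0$ and $D$ are the only ideals $I$ of $D$ with $\sigma(I)\subseteq I$. $[s,t]=st-ts$. $\mathbb{F}_p=\mathbb{Z}/p\mathbb{Z}$. *)

(* Defs.v *)
From HB Require Import structures.
From mathcomp Require Import all_boot all_algebra.
From mathcomp Require Import boolp.

Set Implicit Arguments.
Unset Strict Implicit.
Unset Printing Implicit Defensive.

Import GRing.Theory.
Local Open Scope ring_scope.
Local Open Scope quotient_scope.

Definition is_unit (R : pzRingType) (u : R) : Prop :=
  exists v : R, v * u = 1 /\ u * v = 1.

Definition two_sided_ideal (R : pzRingType) (I : R -> Prop) : Prop :=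
  [/\ I 0, forall u v, I u -> I v -> I (u - v)
    & forall a u, I u -> I (a * u) /\ I (u * a)].

Definition simple_ring (R : pzRingType) : Prop :=
  (1 : R) <> 0 /\
  forall I : R -> Prop, two_sided_ideal I ->
    (forall u, I u -> u = 0) \/ (forall u, I u).

Definition endo_simple (R : pzRingType) (sigma : R -> R) : Prop :=
  forall I : R -> Prop, two_sided_ideal I ->
    (forall u, I u -> I (sigma u)) ->
    (forall u, I u -> u = 0) \/ (forall u, I u).

(* D[h; nu], with coefficients on the left: sum_i d_i h^i is stored as the
   polynomial with coefficients d_i, only the product is twisted. *)
Definition skewpoly (D : nzRingType) (nu : {rmorphism D -> D}) : Type :=
  {poly D}.

Section SkewPoly.
Variables (D : nzRingType) (nu : {rmorphism D -> D}).

Local Notation skewpoly := (skewpoly nu).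

HB.instance Definition _ := GRing.Zmodule.copy skewpoly {poly D}.

Implicit Types p q r : skewpoly.

Definition skew_one : skewpoly := (1 : {poly D}).

(* (a h^i) (c h^j) = a nu^i(c) h^(i + j) *)
Definition skew_mul p q : skewpoly :=
  \poly_(k < size (p : {poly D}) + size (q : {poly D}))
    \sum_(i < k.+1) (p : {poly D})`_i * iter i nu (q : {poly D})`_(k - i).

Lemma skew_iter0 i : iter i nu 0 = 0.
Proof. by elim: i => //= i ->; rewrite rmorph0. Qed.
Lemma skew_iter1 i : iter i nu 1 = 1.
Proof. by elim: i => //= i ->; rewrite rmorph1. Qed.
Lemma skew_iterD i a c : iter i nu (a + c) = iter i nu a + iter i nu c.
Proof. by elim: i => //= i ->; rewrite rmorphD. Qed.
Lemma skew_iterM i a c : iter i nu (a * c) = iter i nu a * iter i nu c.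
Proof. by elim: i => //= i ->; rewrite rmorphM. Qed.

Lemma skew_coefM p q k : (skew_mul p q : {poly D})`_k =
  \sum_(i < k.+1) (p : {poly D})`_i * iter i nu (q : {poly D})`_(k - i).
Proof.
rewrite coef_poly; case: ltnP => // le_k; rewrite big1 // => i _.
have [le_pi|lt_ip] := leqP (size (p : {poly D})) i.
  by rewrite [X in X * _]nth_default // mul0r.
rewrite [X in iter _ _ X]nth_default ?skew_iter0 ?mulr0 //.
rewrite leq_subRL; last by rewrite -ltnS.
apply: leq_trans le_k; rewrite leq_add2r; exact: ltnW.
Qed.

Lemma skew_mul1r : left_id skew_one skew_mul.
Proof.
move=> p; apply/polyP=> k; rewrite skew_coefM big_ord_recl /= coefC mul1r subn0.
by rewrite big1 ?addr0 // => i _; rewrite coefC /= mul0r.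
Qed.

Lemma skew_mulr1 : right_id skew_one skew_mul.
Proof.
move=> p; apply/polyP=> k; rewrite skew_coefM big_ord_recr /= coefC subnn.
rewrite skew_iter1 mulr1 big1 ?add0r // => i _.
by rewrite coefC subn_eq0 leqNgt ltn_ord /= skew_iter0 mulr0.
Qed.

Lemma skew_mulDl : left_distributive skew_mul +%R.
Proof.
move=> p q r; apply/polyP=> k; rewrite coefD !skew_coefM -big_split /=.
by apply: eq_bigr => i _; rewrite coefD mulrDl.
Qed.

Lemma skew_mulDr : right_distributive skew_mul +%R.
Proof.
move=> p q r; apply/polyP=> k; rewrite coefD !skew_coefM -big_split /=.
by apply: eq_bigr => i _; rewrite coefD skew_iterD mulrDr.
Qed.

Lemma skew_iter_sum i n (F : 'I_n -> D) :
  iter i nu (\sum_(j < n) F j) = \sum_(j < n) iter i nu (F j).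
Proof. by apply: (big_morph _ (@skew_iterD i) (skew_iter0 i)). Qed.

Lemma skew_mulA : associative skew_mul.
Proof.
move=> p q r; apply/polyP=> k; rewrite !skew_coefM.
under eq_bigr => i _.
  rewrite skew_coefM skew_iter_sum mulr_sumr.
  under eq_bigr => j _ do rewrite skew_iterM -iterD mulrA -subnDA.
  over.
under [RHS]eq_bigr => i _ do rewrite skew_coefM mulr_suml.
pose F (i m : nat) := (p : {poly D})`_i * iter i nu (q : {poly D})`_(m - i) *
                      iter m nu (r : {poly D})`_(k - m).
transitivity (\sum_(i < k.+1) \sum_(m < k.+1 | (i <= m)%N) F i m).
  apply: eq_bigr => i _.
  rewrite -(big_mkord (fun m => (i <= m)%N) (F i)) /=.
  rewrite (big_cat_nat (n := i)) //=; last exact: ltnW.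
  rewrite [X in _ = X + _]big_nat_cond [X in _ = X + _]big1 ?add0r; last first.
    by move=> j /andP[/andP[_ lt_ji] le_ij]; rewrite ltnNge le_ij in lt_ji.
  rewrite -[X in _ = \sum_(X <= _ < _ | _) _]add0n big_addn big_mkord -subSn; last by rewrite -ltnS.
  rewrite [RHS](eq_bigl predT) => [|j]; last by rewrite leq_addl.
  by apply: eq_bigr => j _; rewrite /F addnK addnC.
rewrite (exchange_big_dep predT) //=; apply: eq_bigr => m _.
rewrite -(big_mkord (fun i => (i <= m)%N) (fun i => F i m)) /=.
rewrite (big_cat_nat (n := m.+1)) //= [X in _ + X]big_nat_cond [X in _ + X]big1.
  rewrite addr0 big_mkord [LHS](eq_bigl predT) //.
  by move=> i; rewrite -ltnS ltn_ord.
by move=> i /andP[/andP[lt_mi _] le_im]; rewrite ltnNge le_im in lt_mi.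
Qed.

Lemma skew_one_neq0 : skew_one != 0.
Proof. exact: (oner_neq0 {poly D}). Qed.

HB.instance Definition _ := GRing.Zmodule_isNzRing.Build skewpoly
  skew_mulA skew_mul1r skew_mulr1 skew_mulDl skew_mulDr skew_one_neq0.

Definition skewC (d : D) : skewpoly := (d%:P : {poly D}).
Definition skewX : skewpoly := ('X : {poly D}).

Lemma skew_coefCM d p k : (skewC d * p : {poly D})`_k = d * (p : {poly D})`_k.
Proof.
rewrite skew_coefM big_ord_recl /= coefC subn0 big1 ?addr0 // => i _.
by rewrite coefC /= mul0r.
Qed.

Lemma skewC_zmod : zmod_morphism skewC.
Proof. by move=> a c; rewrite /skewC polyCB. Qed.

Lemma skewC_monoid : monoid_morphism skewC.
Proof.
split=> // a c; apply/polyP=> k; rewrite skew_coefCM !coefC.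
by case: eqP; rewrite ?mulr0.
Qed.

HB.instance Definition _ := GRing.isZmodMorphism.Build D skewpoly skewC skewC_zmod.
HB.instance Definition _ :=
  GRing.isMonoidMorphism.Build D skewpoly skewC skewC_monoid.

Lemma skew_coefMX p k :
  (p * skewX : {poly D})`_k = if k is k'.+1 then (p : {poly D})`_k' else 0.
Proof.
rewrite skew_coefM; case: k => [|k].
  by rewrite big_ord1 coefX /= mulr0.
rewrite big_ord_recr subnn coefX skew_iter0 mulr0 /= addr0.
rewrite big_ord_recr /= subSnn coefX /= skew_iter1 mulr1.
rewrite big1 ?add0r // => i _.
rewrite coefX subSn; last exact: ltnW.
by rewrite eqSS subn_eq0 leqNgt ltn_ord /= skew_iter0 mulr0.
Qed.

Lemma skewXC d : skewX * skewC d = skewC (nu d) * skewX.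
Proof.
apply/polyP=> k; rewrite skew_coefMX skew_coefM.
case: k => [|k]; first by rewrite big_ord1 coefX mul0r.
rewrite big_ord_recl coefX mul0r add0r big_ord_recl /= coefX mul1r subSS subn0.
rewrite big1 ?addr0; last by move=> i _; rewrite coefX mul0r.
by rewrite !coefC; case: eqP => //= _; rewrite rmorph0.
Qed.

Lemma skew_coefXn n k : (skewX ^+ n : {poly D})`_k = (k == n)%:R.
Proof.
elim: n k => [|n IHn] k; first by rewrite expr0 coefC; case: eqP.
by rewrite exprSr skew_coefMX; case: k => [|k]; rewrite ?IHn.
Qed.

(* The elements h^n form a basis of D[h; nu] as a left D-module. *)
Lemma skewpolyE p : p = \sum_(i < size (p : {poly D}))
  skewC (p : {poly D})`_i * skewX ^+ i.
Proof.
apply/polyP=> k; rewrite (@coef_sum D).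
under eq_bigr => i _ do rewrite skew_coefCM skew_coefXn.
have [le_pk|lt_kp] := leqP (size (p : {poly D})) k.
  rewrite nth_default // big1 // => i _.
  by rewrite gtn_eqF ?mulr0 // (leq_trans (ltn_ord i)).
rewrite (bigD1 (Ordinal lt_kp)) //= eqxx mulr1 big1 ?addr0 // => i.
by rewrite -val_eqE /= eq_sym => /negPf->; rewrite mulr0.
Qed.

End SkewPoly.

(* Substitution of H for h in D[h; nu], with coefficients mapped by f. *)
Definition skew_eval (D : nzRingType) (nu : {rmorphism D -> D}) (S : pzRingType)
    (f : D -> S) (H : S) (u : skewpoly nu) : S :=
  \sum_(i < size (u : {poly D})) f (u : {poly D})`_i * H ^+ i.

Section SkewEval.
Variables (D : nzRingType) (nu : {rmorphism D -> D}) (S : pzRingType).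
Variables (f : {rmorphism D -> S}) (H : S).
Hypothesis Hf : forall d, H * f d = f (nu d) * H.
Local Notation ev := (@skew_eval D nu S f H).

Lemma skew_eval_wide n (u : skewpoly nu) : (size (u : {poly D}) <= n)%N ->
  ev u = \sum_(i < n) f (u : {poly D})`_i * H ^+ i.
Proof.
move=> le_un; rewrite /skew_eval.
rewrite (big_ord_widen n (fun i => f (u : {poly D})`_i * H ^+ i)) //.
rewrite big_mkcond; apply: eq_bigr => i _; case: ltnP => // le_ui.
by rewrite nth_default // rmorph0 mul0r.
Qed.

Lemma skew_eval_zmod : zmod_morphism ev.
Proof.
move=> u v.
pose n := maxn (size (u : {poly D})) (size (v : {poly D})).
have le_un : (size (u : {poly D}) <= n)%N by rewrite leq_maxl.
have le_vn : (size (v : {poly D}) <= n)%N by rewrite leq_maxr.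
have le_uvn : (size (u - v : {poly D})%R <= n)%N.
  by rewrite (leq_trans (size_polyD _ _)) // (@size_polyN D).
rewrite (skew_eval_wide le_uvn) (skew_eval_wide le_un) (skew_eval_wide le_vn).
rewrite -sumrB; apply: eq_bigr => i _.
by rewrite (@coefB D) rmorphB mulrBl.
Qed.

HB.instance Definition _ :=
  GRing.isZmodMorphism.Build (skewpoly nu) S ev skew_eval_zmod.

Lemma skew_evalC d : ev (skewC nu d) = f d.
Proof.
rewrite (@skew_eval_wide 1) ?size_polyC; last by case: eqP.
by rewrite big_ord1 coefC mulr1.
Qed.

Lemma skew_eval_CM d (u : skewpoly nu) : ev (skewC nu d * u) = f d * ev u.
Proof.
rewrite [ev u](@skew_eval_wide _ _ (leqnn _)).
rewrite (@skew_eval_wide (size (u : {poly D}))).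
  by rewrite mulr_sumr; apply: eq_bigr => i _; rewrite skew_coefCM rmorphM mulrA.
by apply/leq_sizeP => j le_uj; rewrite skew_coefCM nth_default ?mulr0.
Qed.

Lemma skew_eval_MX (u : skewpoly nu) : ev (u * skewX nu) = ev u * H.
Proof.
rewrite [ev u](@skew_eval_wide _ _ (leqnn _)).
rewrite (@skew_eval_wide (size (u : {poly D})).+1).
  rewrite big_ord_recl skew_coefMX rmorph0 mul0r add0r mulr_suml.
  by apply: eq_bigr => i _; rewrite skew_coefMX exprSr mulrA.
by apply/leq_sizeP => -[|j] // le_uj; rewrite skew_coefMX nth_default.
Qed.

Lemma skew_evalX : ev (skewX nu) = H.
Proof. by rewrite -[skewX nu]mul1r skew_eval_MX -(rmorph1 (skewC nu)) skew_evalC rmorph1 mul1r. Qed.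

Lemma skew_evalM (u v : skewpoly nu) : ev (u * v) = ev u * ev v.
Proof.
have key i d : ev (skewX nu ^+ i * skewC nu d) = H ^+ i * f d.
  elim: i d => [|i IHi] d; first by rewrite !expr0 !mul1r skew_evalC.
  rewrite exprSr -mulrA skewXC mulrA skew_eval_MX IHi.
  by rewrite -mulrA -Hf mulrA -exprSr.
have MXn w j : ev (w * skewX nu ^+ j) = ev w * H ^+ j.
  elim: j => [|j IHj]; first by rewrite !expr0 !mulr1.
  by rewrite !exprSr !mulrA skew_eval_MX IHj.
rewrite {1}[u]skewpolyE mulr_suml (raddf_sum ev).
rewrite [in RHS]/skew_eval big_distrlr; apply: eq_bigr => i _.
rewrite {1}[v]skewpolyE mulr_sumr (raddf_sum ev); apply: eq_bigr => j _ /=.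
by rewrite -mulrA skew_eval_CM !mulrA MXn key !mulrA.
Qed.

End SkewEval.

Section Diskew.
Variable D : nzRingType.

Inductive word : Type :=
  | WC of D | WX | WY
  | WAdd of word & word | WOpp of word | WMul of word & word.

HB.instance Definition _ := gen_eqMixin word.
HB.instance Definition _ := gen_choiceMixin word.

Variables (sigma tau : {rmorphism D -> D}) (b rho : D).

(* The least congruence on words making the quotient a ring, WC a ring
   morphism, and the defining relations true. *)
Inductive weq : word -> word -> Prop :=
  | weq_refl s : weq s s
  | weq_sym s t : weq s t -> weq t s
  | weq_trans s t u : weq s t -> weq t u -> weq s u
  | weq_add s s' t t' : weq s s' -> weq t t' -> weq (WAdd s t) (WAdd s' t')
  | weq_opp s s' : weq s s' -> weq (WOpp s) (WOpp s')
  | weq_mul s s' t t' : weq s s' -> weq t t' -> weq (WMul s t) (WMul s' t')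
  | weq_addA s t u : weq (WAdd s (WAdd t u)) (WAdd (WAdd s t) u)
  | weq_addC s t : weq (WAdd s t) (WAdd t s)
  | weq_add0 s : weq (WAdd (WC 0) s) s
  | weq_addN s : weq (WAdd (WOpp s) s) (WC 0)
  | weq_mulA s t u : weq (WMul s (WMul t u)) (WMul (WMul s t) u)
  | weq_mul1l s : weq (WMul (WC 1) s) s
  | weq_mul1r s : weq (WMul s (WC 1)) s
  | weq_mulDl s t u : weq (WMul (WAdd s t) u) (WAdd (WMul s u) (WMul t u))
  | weq_mulDr s t u : weq (WMul s (WAdd t u)) (WAdd (WMul s t) (WMul s u))
  | weq_CD a c : weq (WC (a + c)) (WAdd (WC a) (WC c))
  | weq_CM a c : weq (WC (a * c)) (WMul (WC a) (WC c))
  | weq_Xd d : weq (WMul WX (WC d)) (WMul (WC (sigma d)) WX)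
  | weq_Yd d : weq (WMul WY (WC d)) (WMul (WC (tau d)) WY)
  | weq_XY : weq (WAdd (WMul WX WY) (WOpp (WMul (WC rho) (WMul WY WX)))) (WC b).

Definition weqb : rel word := fun s t => `[< weq s t >].

Lemma weqb_refl : reflexive weqb.
Proof. by move=> s; apply/asboolP; exact: weq_refl. Qed.
Lemma weqb_sym : symmetric weqb.
Proof. by move=> s t; apply/asboolP/asboolP; exact: weq_sym. Qed.
Lemma weqb_trans : transitive weqb.
Proof.
by move=> t s u /asboolP st /asboolP tu; apply/asboolP; exact: weq_trans tu.
Qed.

Canonical weqb_equiv := EquivRel weqb weqb_refl weqb_sym weqb_trans.

(* E = D[x, y; sigma, tau, b, rho] *)
Definition diskew : Type := {eq_quot weqb}.
HB.instance Definition _ := Choice.on diskew.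
HB.instance Definition _ := EqQuotient.on diskew.

Definition dsk (s : word) : diskew := \pi_diskew s.

Lemma dskP s t : (dsk s = dsk t) <-> weq s t.
Proof.
split=> [/eqP|st].
  by rewrite /dsk piE => /asboolP.
by apply/eqP; rewrite /dsk piE; apply/asboolP.
Qed.

Lemma dsk_repr (u : diskew) : dsk (repr u) = u.
Proof. exact: reprK. Qed.

Lemma repr_dsk s : weq (repr (dsk s)) s.
Proof. by apply/dskP; rewrite dsk_repr. Qed.

Definition dsk_zero := dsk (WC 0).
Definition dsk_one := dsk (WC 1).
Definition dsk_opp (u : diskew) := dsk (WOpp (repr u)).
Definition dsk_add (u v : diskew) := dsk (WAdd (repr u) (repr v)).
Definition dsk_mul (u v : diskew) := dsk (WMul (repr u) (repr v)).

Lemma dsk_oppE s : dsk_opp (dsk s) = dsk (WOpp s).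
Proof. by apply/dskP/weq_opp/repr_dsk. Qed.
Lemma dsk_addE s t : dsk_add (dsk s) (dsk t) = dsk (WAdd s t).
Proof. by apply/dskP/weq_add; apply: repr_dsk. Qed.
Lemma dsk_mulE s t : dsk_mul (dsk s) (dsk t) = dsk (WMul s t).
Proof. by apply/dskP/weq_mul; apply: repr_dsk. Qed.
Lemma dskW (P : diskew -> Prop) : (forall s, P (dsk s)) -> forall u, P u.
Proof. by move=> Ps u; rewrite -(dsk_repr u). Qed.

Lemma dsk_addA : associative dsk_add.
Proof.
elim/dskW=> s; elim/dskW=> t; elim/dskW=> u; rewrite !dsk_addE.
exact/dskP/weq_addA.
Qed.
Lemma dsk_addC : commutative dsk_add.
Proof. elim/dskW=> s; elim/dskW=> t; rewrite !dsk_addE; exact/dskP/weq_addC. Qed.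
Lemma dsk_add0 : left_id dsk_zero dsk_add.
Proof. elim/dskW=> s; rewrite dsk_addE; exact/dskP/weq_add0. Qed.
Lemma dsk_addN : left_inverse dsk_zero dsk_opp dsk_add.
Proof. elim/dskW=> s; rewrite dsk_oppE dsk_addE; exact/dskP/weq_addN. Qed.
Lemma dsk_mulA : associative dsk_mul.
Proof.
elim/dskW=> s; elim/dskW=> t; elim/dskW=> u; rewrite !dsk_mulE.
exact/dskP/weq_mulA.
Qed.
Lemma dsk_mul1l : left_id dsk_one dsk_mul.
Proof. elim/dskW=> s; rewrite dsk_mulE; exact/dskP/weq_mul1l. Qed.
Lemma dsk_mul1r : right_id dsk_one dsk_mul.
Proof. elim/dskW=> s; rewrite dsk_mulE; exact/dskP/weq_mul1r. Qed.
Lemma dsk_mulDl : left_distributive dsk_mul dsk_add.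
Proof.
elim/dskW=> s; elim/dskW=> t; elim/dskW=> u.
rewrite !(dsk_mulE, dsk_addE); exact/dskP/weq_mulDl.
Qed.
Lemma dsk_mulDr : right_distributive dsk_mul dsk_add.
Proof.
elim/dskW=> s; elim/dskW=> t; elim/dskW=> u.
rewrite !(dsk_mulE, dsk_addE); exact/dskP/weq_mulDr.
Qed.

HB.instance Definition _ := GRing.isZmodule.Build diskew
  dsk_addA dsk_addC dsk_add0 dsk_addN.
HB.instance Definition _ := GRing.Zmodule_isPzRing.Build diskew
  dsk_mulA dsk_mul1l dsk_mul1r dsk_mulDl dsk_mulDr.

Definition diskewC (d : D) : diskew := dsk (WC d).
Definition diskewX : diskew := dsk WX.
Definition diskewY : diskew := dsk WY.

Lemma diskewCD a c : diskewC (a + c) = diskewC a + diskewC c.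
Proof. rewrite -[RHS]/(dsk_add _ _) dsk_addE; exact/dskP/weq_CD. Qed.

Lemma diskewC_zmod : zmod_morphism diskewC.
Proof.
have C0 : diskewC 0 = 0 by [].
move=> a c; rewrite diskewCD; congr (_ + _); apply/eqP.
by rewrite -addr_eq0 -diskewCD addNr C0.
Qed.

Lemma diskewC_monoid : monoid_morphism diskewC.
Proof.
split=> // a c; rewrite -[RHS]/(dsk_mul _ _) dsk_mulE; exact/dskP/weq_CM.
Qed.

HB.instance Definition _ := GRing.isZmodMorphism.Build D diskew diskewC diskewC_zmod.
HB.instance Definition _ :=
  GRing.isMonoidMorphism.Build D diskew diskewC diskewC_monoid.

Lemma diskewXd d : diskewX * diskewC d = diskewC (sigma d) * diskewX.
Proof.
rewrite -[LHS]/(dsk_mul _ _) -[RHS]/(dsk_mul _ _) !dsk_mulE.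
exact/dskP/weq_Xd.
Qed.
Lemma diskewYd d : diskewY * diskewC d = diskewC (tau d) * diskewY.
Proof.
rewrite -[LHS]/(dsk_mul _ _) -[RHS]/(dsk_mul _ _) !dsk_mulE.
exact/dskP/weq_Yd.
Qed.
Lemma diskewXY :
  diskewX * diskewY - diskewC rho * (diskewY * diskewX) = diskewC b.
Proof.
rewrite -[LHS]/(dsk_add (dsk_mul (dsk WX) (dsk WY))
  (dsk_opp (dsk_mul (dsk (WC rho)) (dsk_mul (dsk WY) (dsk WX))))).
rewrite !dsk_mulE dsk_oppE dsk_addE; exact/dskP/weq_XY.
Qed.

Section Lift.
Variables (S : pzRingType) (f : {rmorphism D -> S}) (X Y : S).
Hypothesis X_d : forall d, X * f d = f (sigma d) * X.
Hypothesis Y_d : forall d, Y * f d = f (tau d) * Y.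
Hypothesis X_Y : X * Y - f rho * (Y * X) = f b.

Fixpoint word_eval (s : word) : S :=
  match s with
  | WC d => f d | WX => X | WY => Y
  | WAdd t u => word_eval t + word_eval u
  | WOpp t => - word_eval t
  | WMul t u => word_eval t * word_eval u
  end.

Lemma word_eval_weq s t : weq s t -> word_eval s = word_eval t.
Proof.
elim=> //=; intros; rewrite ?rmorph0 ?rmorph1 ?rmorphD ?rmorphM //.
- congruence.
- congruence.
- congruence.
- congruence.
- by rewrite addrA.
- by rewrite addrC.
- by rewrite add0r.
- by rewrite addNr.
- by rewrite mulrA.
- by rewrite mul1r.
- by rewrite mulr1.
- by rewrite mulrDl.
- by rewrite mulrDr.
Qed.

Definition diskew_lift (u : diskew) : S := word_eval (repr u).

Lemma diskew_liftE s : diskew_lift (dsk s) = word_eval s.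
Proof. exact/word_eval_weq/repr_dsk. Qed.

Lemma diskew_lift_zmod : zmod_morphism diskew_lift.
Proof.
elim/dskW=> s; elim/dskW=> t.
rewrite -[dsk s - _]/(dsk_add _ (dsk_opp _)) dsk_oppE dsk_addE.
by rewrite !diskew_liftE.
Qed.

Lemma diskew_lift_monoid : monoid_morphism diskew_lift.
Proof.
split; first by rewrite [LHS]diskew_liftE /= rmorph1.
elim/dskW=> s; elim/dskW=> t.
by rewrite -[dsk s * _]/(dsk_mul _ _) dsk_mulE !diskew_liftE.
Qed.

HB.instance Definition _ :=
  GRing.isZmodMorphism.Build diskew S diskew_lift diskew_lift_zmod.
HB.instance Definition _ :=
  GRing.isMonoidMorphism.Build diskew S diskew_lift diskew_lift_monoid.

Lemma diskew_universal :
  exists g : {rmorphism diskew -> S},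
    [/\ forall d, g (diskewC d) = f d, g diskewX = X, g diskewY = Y
      & forall g' : {rmorphism diskew -> S},
          (forall d, g' (diskewC d) = f d) -> g' diskewX = X ->
          g' diskewY = Y -> g' =1 g].
Proof.
exists (diskew_lift : {rmorphism diskew -> S}).
split=> [d|||g' gd gX gY]; rewrite /= ?diskew_liftE //.
elim/dskW=> s; rewrite diskew_liftE.
elim: s => //= [t IHt u IHu|t IHt|t IHt u IHu].
- by rewrite -dsk_addE -[dsk_add _ _]/(dsk t + dsk u) rmorphD IHt IHu.
- by rewrite -dsk_oppE -[dsk_opp _]/(- dsk t) rmorphN IHt.
- by rewrite -dsk_mulE -[dsk_mul _ _]/(dsk t * dsk u) rmorphM IHt IHu.
Qed.

End Lift.
End Diskew.

Section DiskewData.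
Variables (D : nzRingType) (sigma tau : {rmorphism D -> D}) (b rho : D).

Definition diskew_nu : {rmorphism D -> D} := (tau \o sigma : {rmorphism D -> D}).

(* rho_i^nu = rho nu(rho) ... nu^(i-1)(rho) *)
Definition rho_nu (i : nat) : D := \prod_(0 <= k < i) iter k diskew_nu rho.

(* a_i = sigma^(i-1)(rho) ... sigma(rho) rho *)
Definition a_seq (i : nat) : D := \prod_(0 <= k < i) iter (i - k.+1) sigma rho.

Definition b_seq (i : nat) : D :=
  \sum_(1 <= j < i) iter j sigma (a_seq (i - j)) * iter j.-1 sigma b
  + iter i.-1 sigma b.

Definition sigma_h : skewpoly diskew_nu -> skewpoly diskew_nu :=
  skew_eval (skewC diskew_nu \o sigma)
    (skewC diskew_nu rho * skewX diskew_nu + skewC diskew_nu b).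

(* D[h; nu] maps to E by h |-> y x. *)
Lemma skewpoly_diskew :
  exists g : {rmorphism skewpoly diskew_nu -> diskew sigma tau b rho},
    (forall d, g (skewC _ d) = diskewC sigma tau b rho d) /\
    g (skewX _) = diskewY sigma tau b rho * diskewX sigma tau b rho.
Proof.
pose C := diskewC sigma tau b rho.
pose H := diskewY sigma tau b rho * diskewX sigma tau b rho.
have HC d : H * C d = C (diskew_nu d) * H.
  by rewrite -mulrA diskewXd mulrA diskewYd -mulrA.
pose ev := @skew_eval D diskew_nu _ C H.
have sz : zmod_morphism ev := @skew_eval_zmod _ diskew_nu _ C H.
have sm : monoid_morphism ev.
  split; last exact: (@skew_evalM _ _ _ C _ HC).
  by rewrite -[LHS]/(ev (skewC _ 1)) [LHS](@skew_evalC _ _ _ C) rmorph1.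
pose iA := GRing.isZmodMorphism.Build _ _ ev sz.
pose iM := GRing.isMonoidMorphism.Build _ _ ev sm.
exists (HB.pack_for {rmorphism skewpoly diskew_nu -> diskew sigma tau b rho}
  ev iA iM).
split=> [d|]; first exact: (@skew_evalC _ _ _ C).
exact: (@skew_evalX _ _ _ C).
Qed.

Hypothesis Hrho : forall d, sigma (tau d) * rho = rho * tau (sigma d).
Hypothesis Hb : forall d, sigma (tau d) * b = b * d.

Lemma sigma_h_comm d :
  let nu := diskew_nu in let H := skewC nu rho * skewX nu + skewC nu b in
  H * skewC nu (sigma d) = skewC nu (sigma (nu d)) * H.
Proof.
move=> nu H; rewrite /H mulrDl mulrDr -mulrA skewXC !mulrA -!rmorphM /=.
by rewrite -Hrho -Hb.
Qed.

(* sigma_h is the ring endomorphism of D[h; nu] that extends sigma and sends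
   h to rho h + b. *)
Lemma sigma_hP : exists g : {rmorphism skewpoly diskew_nu -> skewpoly diskew_nu},
  [/\ g =1 sigma_h, forall d, sigma_h (skewC _ d) = skewC _ (sigma d)
    & sigma_h (skewX _) = skewC _ rho * skewX _ + skewC _ b].
Proof.
pose f : {rmorphism D -> skewpoly diskew_nu} := skewC diskew_nu \o sigma.
have Hf d := sigma_h_comm d.
have sz : zmod_morphism sigma_h := @skew_eval_zmod _ _ _ f _.
have sm : monoid_morphism sigma_h.
  split; last exact: (@skew_evalM _ _ _ f _ Hf).
  by rewrite -[LHS]/(sigma_h (skewC _ 1)) [LHS](@skew_evalC _ _ _ f) /= !rmorph1.
pose iA := GRing.isZmodMorphism.Build _ _ sigma_h sz.
pose iM := GRing.isMonoidMorphism.Build _ _ sigma_h sm.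
exists (HB.pack_for {rmorphism skewpoly diskew_nu -> skewpoly diskew_nu}
  sigma_h iA iM).
split=> // [d|]; first exact: (@skew_evalC _ _ _ f).
exact: (@skew_evalX _ _ _ f).
Qed.

Lemma a_seqS i : a_seq i.+1 = sigma (a_seq i) * rho.
Proof.
rewrite /a_seq big_nat_recr //= subnn rmorph_prod; congr (_ * _).
by rewrite !big_mkord; apply: eq_bigr => k _; rewrite subSS -iterS -subSn.
Qed.

Lemma b_seqS i : (0 < i)%N ->
  b_seq i.+1 = sigma (a_seq i) * b + sigma (b_seq i).
Proof.
move=> i_gt0; rewrite /b_seq big_ltn //= subSS subn0 -addrA; congr (_ + _).
rewrite rmorphD rmorph_sum -iterS prednK //; congr (_ + _).
rewrite big_add1 /=; apply: eq_big_nat => j /andP[j_gt0 _].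
by rewrite subSS rmorphM -iterS -[in RHS]iterS prednK.
Qed.

(* The definitions of a_i and b_i agree with sigma^i(h) = a_i h + b_i. *)
Lemma sigma_h_iter i : (0 < i)%N ->
  iter i sigma_h (skewX _) = skewC _ (a_seq i) * skewX _ + skewC _ (b_seq i).
Proof.
have [g [gE gC gX]] := sigma_hP.
case: i => // i _; elim: i => [|i IHi].
  by rewrite [LHS]gX /a_seq /b_seq big_nat1 big_geq // add0r.
rewrite iterS IHi -gE rmorphD rmorphM !gE !gC gX (a_seqS i.+1) (@b_seqS i.+1) //.
by rewrite mulrDr mulrA -!rmorphM -addrA -(rmorphD (skewC _)).
Qed.

End DiskewData.

Arguments sigma_h {D} sigma tau b rho u.

(* Main.v *)
From HB Require Import structures.
Require Import Defs.
From mathcomp Require Import all_boot all_algebra.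
From mathcomp Require Import boolp zify.

Set Implicit Arguments.
Unset Strict Implicit.
Unset Printing Implicit Defensive.

Import GRing.Theory.
Local Open Scope ring_scope.

(** Why the criterion holds. Write [DD] for [D[h; nu]], with [h = yx], and
    [sigma] also for the endomorphism of [DD] sending [h] to [rho h + b].

    If [E] is simple, every representation of [E] that kills a nonzero element
    is zero. The representations used are weight modules: functions [phi] on
    a set of weights, on which [x] acts by a shift, [y] by a weighted shift back,
    and [DD] diagonally ([weight_transporter]). With weights the natural numbers
    and values in [D], the element [h] acts at weight [i] by [b_i]: values modulo
    a [sigma]-stable ideal of [D] give [sigma]-simplicity
    ([simple_endo_simple]), and the functions cut off at weight [i], modulo
    [D b_i], form a module killed by [x^i], whence [b_i] is a unit
    ([simple_b_unit]). That [sigma] and [tau] are bijective then follows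
    formally. With weights the integers and values in [DD], taking values
    modulo a polynomial [p'] of the forbidden kind gives a nonzero module that
    [p'] kills ([simple_no_normal]).

    Coefficients satisfying the third condition yield such a polynomial [p'],
    because [rho h] and [b] commute, so that
    [(rho h + b)^q = (rho h)^q + b^q] for every power [q] of [p]
    ([obstruction_normal]).

    Assume finally the third condition, and let [I] be a nonzero ideal of [E].
    Every element of [E] is a sum of terms [u x^i] and [u y^i], with [u] in [DD];
    as [yx = h] is regular, [I] contains a nonzero element of the subring
    generated by [DD] and [x] ([diskew_ideal_meets]). An element of [I] of this
    kind, of least degree in [x] after division by powers of [x], has a constant
    term [f] that can be made monic of least degree [k] in [h], since [D] is
    [sigma]-simple. Minimality makes [f] semi-invariant: [f d = nu^k(d) f],
    [h f = f h] and [sigma(f) = rho^nu_k f]. If [k = 0], the units [b_m] leave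
    no room for further terms ([saturated_ideal_unit]), so [I] contains a power
    of [x], and the same units allow one to descend to [1]
    ([diskew_ideal_xpow]). If [k > 0], take a semi-invariant polynomial of least
    positive degree: its divided derivatives are again semi-invariant, hence
    constant, so only monomials [h^(p^i)] and a constant occur
    ([semi_invariant_additive]). The coefficients of this polynomial are those
    excluded by the third condition ([semi_invariant_obstruction]). *)

(** * Coefficients and universal property of a skew polynomial ring *)

Section SkewCoefficients.
Variables (D : nzRingType) (nu : {rmorphism D -> D}).
Implicit Types p q : skewpoly nu.

Definition scoef p (k : nat) : D := (p : {poly D})`_k.

Lemma scoefP p q : (forall k, scoef p k = scoef q k) -> p = q.
Proof. by move=> pq; apply/polyP. Qed.

Lemma scoef0 k : scoef 0 k = 0.
Proof. exact: coef0. Qed.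

Lemma scoefD p q k : scoef (p + q) k = scoef p k + scoef q k.
Proof. exact: coefD. Qed.

Lemma scoefN p k : scoef (- p) k = - scoef p k.
Proof. exact: coefN. Qed.

Lemma scoefB p q k : scoef (p - q) k = scoef p k - scoef q k.
Proof. by rewrite scoefD scoefN. Qed.

Lemma scoef_sum I (s : seq I) (P : pred I) (F : I -> skewpoly nu) k :
  scoef (\sum_(i <- s | P i) F i) k = \sum_(i <- s | P i) scoef (F i) k.
Proof.
by apply: (big_morph (fun p => scoef p k)) => [p q|]; [apply: scoefD | apply: scoef0].
Qed.

Lemma scoefC d k : scoef (skewC nu d) k = if k == 0%N then d else 0.
Proof. exact: coefC. Qed.

Lemma scoef1 k : scoef 1 k = (k == 0%N)%:R.
Proof. by rewrite -(rmorph1 (skewC nu)) scoefC; case: eqP. Qed.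

Lemma scoefX k : scoef (skewX nu) k = (k == 1%N)%:R.
Proof. exact: coefX. Qed.

Lemma scoefXn n k : scoef (skewX nu ^+ n) k = (k == n)%:R.
Proof. exact: skew_coefXn. Qed.

Lemma scoefCM d p k : scoef (skewC nu d * p) k = d * scoef p k.
Proof. exact: skew_coefCM. Qed.

Lemma scoefMX p k :
  scoef (p * skewX nu) k = if k is k'.+1 then scoef p k' else 0.
Proof. exact: skew_coefMX. Qed.

Lemma scoefM p q k :
  scoef (p * q) k = \sum_(i < k.+1) scoef p i * iter i nu (scoef q (k - i)).
Proof. exact: skew_coefM. Qed.

Lemma scoefMC p d k : scoef (p * skewC nu d) k = scoef p k * iter k nu d.
Proof.
rewrite scoefM big_ord_recr /= subnn scoefC /= big1 ?add0r // => i _.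
by rewrite scoefC subn_eq0 leqNgt ltn_ord /= skew_iter0 mulr0.
Qed.

Lemma scoefXM p k :
  scoef (skewX nu * p) k = if k is k'.+1 then nu (scoef p k') else 0.
Proof.
rewrite scoefM; case: k => [|k]; first by rewrite big_ord1 scoefX mul0r.
rewrite !big_ord_recl big1 => [|i _]; last by rewrite scoefX /= mul0r.
by rewrite !scoefX /= mul0r add0r addr0 mul1r subSS subn0.
Qed.

Lemma skewXnC n d :
  skewX nu ^+ n * skewC nu d = skewC nu (iter n nu d) * skewX nu ^+ n.
Proof.
apply: scoefP => k; rewrite scoefMC scoefCM !scoefXn.
by case: eqP => [->|]; rewrite ?mul1r ?mulr1 ?mul0r ?mulr0.
Qed.

Lemma scoef_bound p : exists n, forall k, (n <= k)%N -> scoef p k = 0.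
Proof. by exists (size (p : {poly D})) => k le_k; apply: nth_default. Qed.

Lemma skewpoly_expand n p : (forall k, (n <= k)%N -> scoef p k = 0) ->
  p = \sum_(i < n) skewC nu (scoef p i) * skewX nu ^+ i.
Proof.
move=> p_bound; apply: scoefP => k; rewrite scoef_sum.
under eq_bigr => i _ do rewrite scoefCM scoefXn.
have [le_nk|lt_kn] := leqP n k.
  rewrite p_bound // big1 // => i _.
  by rewrite gtn_eqF ?mulr0 // (leq_trans (ltn_ord i)).
rewrite (bigD1 (Ordinal lt_kn)) //= eqxx mulr1 big1 ?addr0 // => i.
by rewrite -val_eqE /= eq_sym => /negPf->; rewrite mulr0.
Qed.

Lemma scoef_top p : p <> 0 ->
  exists n, scoef p n <> 0 /\ forall k, (n < k)%N -> scoef p k = 0.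
Proof.
move=> p_neq0; have sz_gt0 : (0 < size (p : {poly D}))%N.
  by rewrite size_poly_gt0; apply/eqP.
exists (size (p : {poly D})).-1; split=> [|k].
  by apply/eqP; rewrite -[scoef p _]/(lead_coef (p : {poly D})) lead_coef_eq0; apply/eqP.
by rewrite prednK // => le_k; apply: nth_default.
Qed.

(** Dividing by [h] on the right; used to split off a constant coefficient. *)
Lemma skewpoly_split p :
  exists q, p = skewC nu (scoef p 0) + q * skewX nu
         /\ forall k, scoef q k = scoef p k.+1.
Proof.
exists (drop_poly 1 (p : {poly D}) : skewpoly nu).
have qE k : scoef (drop_poly 1 (p : {poly D}) : skewpoly nu) k = scoef p k.+1.
  by rewrite /scoef coef_drop_poly addn1.
split=> //; apply: scoefP => -[|k]; rewrite scoefD scoefC scoefMX ?addr0 //.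
by rewrite add0r qE.
Qed.

End SkewCoefficients.

Section SkewMaps.
Variables (D : nzRingType) (nu : {rmorphism D -> D}).

(** An identity [x g(u) = g'(u) x] between ring morphisms need only be checked
    on the coefficients and on [h]; the case [x = 1] says that a morphism out of
    [D[h; nu]] is determined there. *)
Lemma skew_intertwine (S : pzRingType) (g g' : {rmorphism skewpoly nu -> S})
    (x : S) :
  (forall d, x * g (skewC nu d) = g' (skewC nu d) * x) ->
  x * g (skewX nu) = g' (skewX nu) * x ->
  forall u, x * g u = g' u * x.
Proof.
move=> xC xX u; have [n /skewpoly_expand->] := scoef_bound u.
rewrite !rmorph_sum mulr_sumr mulr_suml; apply: eq_bigr => i _ /=.
rewrite !rmorphM mulrA xC -!mulrA; congr (_ * _); rewrite !rmorphXn.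
elim: (nat_of_ord i) => [|k IHk]; first by rewrite !expr0 mulr1 mul1r.
by rewrite !exprS mulrA xX -mulrA IHk mulrA.
Qed.

Lemma skew_ext (S : pzRingType) (g g' : {rmorphism skewpoly nu -> S}) :
  (forall d, g (skewC nu d) = g' (skewC nu d)) ->
  g (skewX nu) = g' (skewX nu) -> g =1 g'.
Proof.
move=> gC gX u; have := @skew_intertwine _ g g' 1 _ _ u.
by rewrite !mul1r !mulr1; apply=> // d; rewrite mul1r mulr1.
Qed.

Variables (S : pzRingType) (f : {rmorphism D -> S}) (H : S).
Hypothesis Hf : forall d, H * f d = f (nu d) * H.

Lemma skew_lift_exists :
  exists g : {rmorphism skewpoly nu -> S},
    [/\ g =1 skew_eval f H, forall d, g (skewC nu d) = f d & g (skewX nu) = H].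
Proof.
have sz : zmod_morphism (@skew_eval D nu S f H) by apply: skew_eval_zmod.
have sm : monoid_morphism (@skew_eval D nu S f H).
  split; last exact: (skew_evalM Hf).
  by rewrite -(rmorph1 (skewC nu)) skew_evalC rmorph1.
pose iA := GRing.isZmodMorphism.Build _ _ (@skew_eval D nu S f H) sz.
pose iM := GRing.isMonoidMorphism.Build _ _ (@skew_eval D nu S f H) sm.
exists (HB.pack_for {rmorphism skewpoly nu -> S} (@skew_eval D nu S f H) iA iM).
by split=> // [d|]; [apply: skew_evalC | apply: skew_evalX].
Qed.

End SkewMaps.

Lemma skew_map (D : nzRingType) (nu : {rmorphism D -> D}) (f : D -> D)
    (u : skewpoly nu) : f 0 = 0 ->
  exists v : skewpoly nu, forall k, scoef v k = f (scoef u k).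
Proof.
move=> f0; exists (map_poly f (u : {poly D}) : skewpoly nu) => k.
by rewrite /scoef coef_map_id0.
Qed.

(** * Weight modules of a diskew polynomial ring *)

Section WeightModule.
Variables (D : nzRingType) (sigma tau : {rmorphism D -> D}) (b rho : D).
Variables (S : nzRingType) (K : Type) (next prev : K -> K).
Variables (g : K -> {rmorphism D -> S}) (w : K -> S).
Local Notation E := (diskew sigma tau b rho).
Local Notation dk := (dsk sigma tau b rho).

(** Acting by words first lets the module axioms be checked on generators; the
    action descends to [E] by [word_act_weq]. *)
Fixpoint word_act (s : word D) (phi : K -> S) (k : K) : S :=
  match s with
  | WC d => g k d * phi k
  | WX => phi (next k)
  | WY => w k * phi (prev k)
  | WAdd t u => word_act t phi k + word_act u phi k
  | WOpp t => - word_act t phi k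
  | WMul t u => word_act t (word_act u phi) k
  end.

Definition submodule (W : (K -> S) -> Prop) : Prop :=
  [/\ W (fun=> 0), forall phi psi, W phi -> W psi -> W (fun k => phi k - psi k),
      forall d phi, W phi -> W (fun k => g k d * phi k),
      forall phi, W phi -> W (fun k => phi (next k))
    & forall phi, W phi -> W (fun k => w k * phi (prev k))].

Lemma word_actD s phi psi :
  word_act s (fun k => phi k + psi k) =
  (fun k => word_act s phi k + word_act s psi k).
Proof.
elim: s phi psi => [d|||t IHt u IHu|t IHt|t IHt u IHu] phi psi /=;
  apply: funext => k //=.
- by rewrite mulrDr.
- by rewrite mulrDr.
- by rewrite IHt IHu addrACA.
- by rewrite IHt opprD.
- by rewrite IHu IHt.
Qed.

Lemma submodule_opp W : submodule W -> forall phi, W phi -> W (fun k => - phi k).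
Proof.
case=> W0 WB _ _ _ phi Wphi.
have -> : (fun k => - phi k) = (fun k => 0 - phi k) by apply: funext => k; rewrite sub0r.
exact: WB.
Qed.

Lemma submodule_act W : submodule W -> forall s phi, W phi -> W (word_act s phi).
Proof.
move=> Wsub; have [W0 WB WC_ WX_ WY_] := Wsub.
elim=> [d|||t IHt u IHu|t IHt|t IHt u IHu] phi Wphi /=; auto.
- have -> : (fun k => word_act t phi k + word_act u phi k) =
            (fun k => word_act t phi k - - word_act u phi k).
    by apply: funext => k; rewrite opprK.
  by apply: WB; [apply: IHt|apply/(submodule_opp Wsub)/IHu].
- exact/(submodule_opp Wsub)/IHt.
Qed.

Hypothesis nextK : forall k, prev (next k) = k.
(* A missing predecessor is encoded by a vanishing weight. *)
Hypothesis prevK : forall k, next (prev k) = k \/ w k = 0.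
Hypothesis g_next : forall k d, g (next k) d = g k (sigma d).
Hypothesis g_prev : forall k d, w k * g (prev k) d = g k (tau d) * w k.
Hypothesis w_next : forall k, w (next k) = g k rho * w k + g k b.

Lemma word_act_weq s t : weq sigma tau b rho s t -> word_act s = word_act t.
Proof.
elim=> //= {s t}; intros; apply: funext => phi; apply: funext => k /=.
- congruence.
- congruence.
- congruence.
- congruence.
- by rewrite addrA.
- by rewrite addrC.
- by rewrite rmorph0 mul0r add0r.
- by rewrite addNr rmorph0 mul0r.
- by rewrite rmorph1 mul1r.
- by congr (word_act _ _ _); apply: funext => k'; rewrite rmorph1 mul1r.
- by rewrite -[RHS]/((fun k => _ + _) k) -word_actD.
- by rewrite rmorphD mulrDl.
- by rewrite rmorphM mulrA.
- by rewrite g_next.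
- by rewrite !mulrA g_prev.
- rewrite nextK w_next mulrDl.
  have -> : w k * phi (next (prev k)) = w k * phi k.
    by case: (prevK k) => ->; rewrite ?mul0r.
  by rewrite mulrA addrAC subrr add0r.
Qed.

(** The weight module turns an inclusion of submodules into an ideal of [E],
    the transporter of [W] into [W']; simplicity leaves it two values. *)
Lemma weight_transporter W W' : submodule W -> submodule W' ->
  simple_ring E ->
  (forall s, (forall phi, W phi -> W' (word_act s phi)) -> dk s = 0) \/
  (forall phi, W phi -> W' phi).
Proof.
move=> Wsub W'sub [_ simE].
pose I (u : E) := forall phi, W phi -> W' (word_act (repr u) phi).
have Idk s : I (dk s) <-> forall phi, W phi -> W' (word_act s phi).
  by rewrite /I (word_act_weq (repr_dsk sigma tau b rho s)).
suff Iideal : two_sided_ideal I.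
  have [I0|I1] := simE I Iideal; first by left=> s /Idk/I0.
  right=> phi /((Idk (WC 1)).1 (I1 _)) /=; congr (W' _).
  by apply: funext => k; rewrite rmorph1 mul1r.
split.
- apply/Idk=> phi _ /=; have [W'0 _ _ _ _] := W'sub.
  by congr (W' _): W'0; apply: funext => k; rewrite rmorph0 mul0r.
- elim/dskW=> s; elim/dskW=> t /Idk Is /Idk It.
  rewrite -[dk s - _]/(dsk_add _ (dsk_opp _)) dsk_oppE dsk_addE.
  by apply/Idk=> phi Wphi /=; have [_ W'B _ _ _] := W'sub; apply: W'B; auto.
- elim/dskW=> s; elim/dskW=> t /Idk It.
  rewrite -[dk s * _]/(dsk_mul _ _) -[dk t * _]/(dsk_mul _ _) !dsk_mulE.
  split; apply/Idk=> phi Wphi /=; first exact/(submodule_act W'sub)/It.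
  exact/It/(submodule_act Wsub).
Qed.

Lemma word_act_eq0 s phi : dk s = 0 -> word_act s phi = (fun=> 0).
Proof.
move=> s0; rewrite (@word_act_weq s (WC 0)); last exact/dskP.
by apply: funext => k /=; rewrite rmorph0 mul0r.
Qed.

(** On [D[h; nu]] a weight module is diagonal: [h = yx] acts at [k] by [w k]. *)
Lemma word_act_skewpoly
    (G : K -> {rmorphism skewpoly (diskew_nu sigma tau) -> S}) :
  (forall k d, G k (skewC _ d) = g k d) -> (forall k, G k (skewX _) = w k) ->
  forall u, exists s, forall phi k, word_act s phi k = G k u * phi k.
Proof.
move=> GC GX u; have [n /skewpoly_expand->] := scoef_bound u.
elim: n => [|n [s IHs]].
  by exists (WC 0) => phi k; rewrite big_ord0 /= !rmorph0 !mul0r.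
exists (WAdd s (WMul (WC (scoef u n)) (iter n (WMul (WMul (WY D) (WX D))) (WC 1)))) => phi k /=.
rewrite IHs big_ord_recr rmorphD mulrDl; congr (_ + _).
rewrite rmorphM GC -mulrA rmorphXn GX; congr (_ * _).
elim: n {IHs} k => [|n IHn] k /=; first by rewrite rmorph1.
have -> : w k * word_act (iter n (WMul (WMul (WY D) (WX D))) (WC 1)) phi (next (prev k))
   = w k * word_act (iter n (WMul (WMul (WY D) (WX D))) (WC 1)) phi k.
  by case: (prevK k) => ->; rewrite ?mul0r.
by rewrite IHn exprS mulrA.
Qed.

End WeightModule.

(** * Simplicity of the diskew polynomial ring constrains its coefficients *)

Fixpoint iter_rmorph (R : nzRingType) (f : {rmorphism R -> R}) k : {rmorphism R -> R} :=
  if k is k'.+1 then (f \o iter_rmorph f k' : {rmorphism R -> R}) else idfun.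

Lemma iter_rmorphE (R : nzRingType) (f : {rmorphism R -> R}) k x :
  iter_rmorph f k x = iter k f x.
Proof. by elim: k => //= k <-. Qed.

Lemma iter_onto (T : Type) (f : T -> T) k :
  (forall y, exists x, f x = y) -> forall y, exists x, iter k f x = y.
Proof.
move=> f_onto; elim: k => [|k IHk] y; first by exists y.
by have [x <-] := f_onto y; have [z <-] := IHk x; exists z.
Qed.

Section DiskewConstraints.
Variables (D : nzRingType) (sigma tau : {rmorphism D -> D}) (b rho rhoV : D).
Local Notation nu := (diskew_nu sigma tau).
Local Notation E := (diskew sigma tau b rho).
Local Notation b_ := (b_seq sigma b rho).

Hypothesis sigma_tau_rho : forall d : D, sigma (tau d) * rho = rho * tau (sigma d).
Hypothesis sigma_tau_b : forall d : D, sigma (tau d) * b = b * d.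
Hypothesis rhoVr : rhoV * rho = 1.
Hypothesis rhorV : rho * rhoV = 1.

Lemma rhoV_sigma_tau d : rhoV * sigma (tau d) = nu d * rhoV.
Proof.
rewrite -[LHS]mulr1 -rhorV -mulrA (mulrA _ rho) sigma_tau_rho !mulrA rhoVr.
by rewrite mul1r.
Qed.

Lemma tau_onto : (forall d, exists d', nu d' = d) -> forall d, exists d', tau d' = d.
Proof. by move=> nu_epi d; have [d' <-] := nu_epi d; exists (sigma d'). Qed.

(** [sigma tau] is [nu] followed by conjugation by [rho]. *)
Lemma sigma_onto : (forall d, exists d', nu d' = d) -> forall d, exists d', sigma d' = d.
Proof.
move=> nu_epi d; have [e nu_e] := nu_epi (rhoV * d * rho); exists (tau e).
rewrite -[LHS]mulr1 -rhorV mulrA sigma_tau_rho -[tau _]/(nu e) nu_e.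
by rewrite -!mulrA rhorV mulr1 mulrA rhorV mul1r.
Qed.

(** Expand [sigma^(i+1)(h) = sigma^i(rho h + b)] instead of
    [sigma(sigma^i(h))]. *)
Lemma b_seq_recr i : (0 < i)%N ->
  b_ i.+1 = iter i sigma rho * b_ i + iter i sigma b.
Proof.
move=> i_gt0; have [g [gE gC gX]] := sigma_hP sigma_tau_rho sigma_tau_b.
have gC' j d : iter j (sigma_h sigma tau b rho) (skewC nu d) = skewC nu (iter j sigma d).
  by elim: j => //= j ->.
have gM : forall j u v, iter j (sigma_h sigma tau b rho) (u * v) =
    iter j (sigma_h sigma tau b rho) u * iter j (sigma_h sigma tau b rho) v.
  by elim=> //= j IHj u v; rewrite IHj -!gE rmorphM.
have gD : forall j u v, iter j (sigma_h sigma tau b rho) (u + v) =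
    iter j (sigma_h sigma tau b rho) u + iter j (sigma_h sigma tau b rho) v.
  by elim=> //= j IHj u v; rewrite IHj -!gE rmorphD.
have := sigma_h_iter sigma_tau_rho sigma_tau_b (ltn0Sn i).
rewrite iterSr gX gD gM !gC' (sigma_h_iter sigma_tau_rho sigma_tau_b i_gt0).
move/(congr1 (fun u => scoef u 0)).
rewrite mulrDr mulrA -!rmorphM !scoefD !scoefMX !scoefC /= add0r.
by rewrite add0r => <-.
Qed.

Lemma b_seq1 : b_ 1 = b.
Proof. by rewrite /b_seq big_geq // add0r. Qed.

Lemma b_seq_comm i d : b_ i.+1 * iter i sigma d = iter i.+1 sigma (tau d) * b_ i.+1.
Proof.
elim: i d => [|i IHi] d; first by rewrite b_seq1 /= sigma_tau_b.
rewrite b_seq_recr //; move: (b_ i.+1) IHi => B IHi.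
rewrite mulrDl mulrDr; congr (_ + _).
  rewrite -mulrA (iterSr i sigma d) IHi.
  by rewrite !mulrA (iterSr i.+1 sigma (tau d)) -!(skew_iterM sigma) sigma_tau_rho.
by rewrite (iterSr i.+1) -!(skew_iterM sigma) sigma_tau_b.
Qed.

(** The weights of the weight module over [D] indexed by the natural numbers:
    [h] kills the bottom weight and acts by [b_k] at weight [k]. *)
Definition verma_weight (k : nat) : D := if k is k'.+1 then b_ k else 0.

Let vg := iter_rmorph sigma.
Let verma_nextK : forall k, k.+1.-1 = k. Proof. by []. Qed.
Let verma_prevK k : k.-1.+1 = k \/ verma_weight k = 0.
Proof. by case: k => [|k]; [right|left]. Qed.
Let verma_g_next k d : vg k.+1 d = vg k (sigma d).
Proof. by rewrite !iter_rmorphE iterSr. Qed.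
Let verma_g_prev k d : verma_weight k * vg k.-1 d = vg k (tau d) * verma_weight k.
Proof.
case: k => [|k] /=; first by rewrite mul0r mulr0.
by rewrite !iter_rmorphE b_seq_comm.
Qed.
Let verma_w_next k : verma_weight k.+1 = vg k rho * verma_weight k + vg k b.
Proof.
case: k => [|k]; first by rewrite /= b_seq1 mulr0 add0r.
by rewrite /verma_weight b_seq_recr // /vg !iter_rmorphE.
Qed.

Lemma verma_transporter W W' :
  submodule succn predn vg verma_weight W ->
  submodule succn predn vg verma_weight W' -> simple_ring E ->
  (forall s, (forall phi, W phi -> W' (word_act succn predn vg verma_weight s phi)) ->
     dsk sigma tau b rho s = 0) \/
  (forall phi, W phi -> W' phi).
Proof. exact: weight_transporter. Qed.

Lemma verma_act_eq0 s phi : dsk sigma tau b rho s = 0 ->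
  word_act succn predn vg verma_weight s phi = (fun=> 0).
Proof. exact: word_act_eq0. Qed.

Lemma diskewC_inj d : diskewC sigma tau b rho d = 0 -> d = 0.
Proof.
move/(@verma_act_eq0 (WC d) (fun=> 1))/(congr1 (fun phi => phi 0%N)).
by rewrite /= mulr1.
Qed.

(** A [sigma]-stable ideal [I] kills functions modulo the [I]-valued ones, so it
    lies in an ideal of [E] that is proper when [I] is. *)
Lemma simple_endo_simple : simple_ring E -> endo_simple sigma.
Proof.
move=> simE I [I0 IB IM] sigmaI.
have IvalP : submodule succn predn vg verma_weight (fun phi => forall k, I (phi k)).
  split=> // [phi psi Iphi Ipsi k|d phi Iphi k|phi Iphi k]; first exact: IB.
    exact: (IM _ _ (Iphi k)).1.
  exact: (IM _ _ (Iphi _)).1.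
have [|I_eq0|IT] := @verma_transporter (fun=> True) _ _ IvalP simE; first by split.
- left=> d Id; apply/diskewC_inj/(I_eq0 (WC d)) => phi _ k /=.
  suff /(IM (phi k)) [] : I (vg k d) by [].
  by rewrite iter_rmorphE; elim: k => //= k; apply: sigmaI.
- by right=> d; apply: (IT (fun=> d) _ 0%N).
Qed.

Hypothesis nu_epi : forall d, exists d', nu d' = d.

(** Because [b_i] is normal, functions with values in [D b_i] from index [i] on
    form a submodule, and [x^i] sends it into the [D b_i]-valued functions. *)
Lemma simple_b_unit i : simple_ring E -> (1 <= i)%N -> is_unit (b_ i).
Proof.
case: i => // i simE _; pose N d := exists c, d = c * b_ i.+1.
have NB c d : N c -> N d -> N (c - d).
  by case=> c' -> [d' ->]; exists (c' - d'); rewrite mulrBl.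
have Nl a c : N c -> N (a * c) by case=> c' ->; exists (a * c'); rewrite mulrA.
have Nr a c : N c -> N (c * a).
  case=> c' ->; have [d <-] := iter_onto i (sigma_onto nu_epi) a.
  by rewrite -mulrA b_seq_comm mulrA; eexists; reflexivity.
have N0 : N 0 by exists 0; rewrite mul0r.
have [||Xi_eq0|/(_ (fun k => (k <= i)%:R))] := @verma_transporter
  (fun phi => forall k, (i < k)%N -> N (phi k)) (fun phi => forall k, N (phi k)) _ _ simE.
- split=> // [phi psi Nphi Npsi k lt_ik|d phi Nphi k lt_ik|phi Nphi k lt_ik|phi Nphi k].
  + by apply: NB; auto.
  + by apply: Nl; auto.
  + by apply: Nphi; rewrite ltnW.
  + rewrite leq_eqVlt => /predU1P[<-|lt_ik]; first by apply: Nr; exists 1; rewrite mul1r.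
    by apply/Nl/Nphi; case: k lt_ik.
- by split=> // *; auto.
  (* x^(i+1) does not vanish, as it shifts functions by i+1 *)
- pose s := iter i.+1 (WMul (WX D)) (WC 1).
  have sE phi k : word_act succn predn vg verma_weight s phi k = phi (k + i.+1)%N.
    rewrite /s; elim: i.+1 k => [|j IHj] k /=; first by rewrite addn0 rmorph1 mul1r.
    by rewrite IHj addSnnS.
  have /(@verma_act_eq0 _ (fun=> 1))/(congr1 (fun phi => phi 0%N)) :
      dsk sigma tau b rho s = 0.
    by apply: Xi_eq0 => phi Nphi k; rewrite sE; apply: Nphi; rewrite addnS ltnS leq_addl.
  by rewrite sE => /eqP; rewrite oner_eq0.
- move=> N1; have [k lt_ik|c cb'] := N1 _ 0%N; first by rewrite leqNgt lt_ik; exists 0; rewrite mul0r.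
  have cb : c * b_ i.+1 = 1 by rewrite -cb'.
  have [e eE] := iter_onto i.+1 (sigma_onto nu_epi) c.
  have [e' e'E] := tau_onto nu_epi e.
  have be : b_ i.+1 * iter i sigma e' = 1 by rewrite b_seq_comm e'E eE.
  exists c; split; first by [].
  have -> : c = iter i sigma e' by rewrite -[LHS]mulr1 -be mulrA cb mul1r.
  by rewrite be.
Qed.

Lemma sigma_inj : endo_simple sigma -> forall d, sigma d = 0 -> d = 0.
Proof.
move=> simS; have [|||/(_ 1)] // := simS (fun d => sigma d = 0).
- by split=> [|u v u0 v0|a u u0]; rewrite ?rmorph0 ?rmorphB ?rmorphM ?u0 ?v0 ?subrr ?mulr0 ?mul0r.
- by move=> u ->; rewrite rmorph0.
- by rewrite rmorph1 => /eqP; rewrite oner_eq0.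
Qed.

Lemma tau_inj : is_unit b -> forall d, tau d = 0 -> d = 0.
Proof.
by case=> c [cb _] d d0; rewrite -[d]mul1r -cb -mulrA -sigma_tau_b d0 rmorph0 mul0r mulr0.
Qed.

End DiskewConstraints.

Lemma rmorph_bijective (R : nzRingType) (f : {rmorphism R -> R}) :
  (forall y, exists x, f x = y) -> (forall x, f x = 0 -> x = 0) -> bijective f.
Proof.
move=> f_onto f_inj; have [f' fK] := choice f_onto; exists f' => // x.
by apply/eqP; rewrite -subr_eq0; apply/eqP/f_inj; rewrite rmorphB fK subrr.
Qed.

(** * Normal elements of the coefficient ring *)

Lemma scoefM_top (D : nzRingType) (nu : {rmorphism D -> D}) (p q : skewpoly nu) m n :
  (forall k, (m < k)%N -> scoef p k = 0) -> (forall k, (n < k)%N -> scoef q k = 0) ->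
  scoef (p * q) (m + n) = scoef p m * iter m nu (scoef q n).
Proof.
move=> p_bound q_bound; rewrite scoefM.
have lt_m : (m < (m + n).+1)%N by rewrite ltnS leq_addr.
rewrite (bigD1 (Ordinal lt_m)) //= addKn big1 ?addr0 // => i.
rewrite -val_eqE /= neq_ltn => /orP[lt_im|lt_mi]; last by rewrite p_bound ?mul0r.
by rewrite q_bound ?skew_iter0 ?mulr0 // ltn_subRL ltn_add2r.
Qed.

Section NormalElements.
Variables (D : nzRingType) (sigma tau : {rmorphism D -> D}) (b rho rhoV : D).
Local Notation nu := (diskew_nu sigma tau).
Local Notation DD := (skewpoly nu).
Local Notation C := (skewC nu).
Local Notation h := (skewX nu).
Local Notation E := (diskew sigma tau b rho).

Hypothesis sigma_tau_rho : forall d : D, sigma (tau d) * rho = rho * tau (sigma d).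
Hypothesis sigma_tau_b : forall d : D, sigma (tau d) * b = b * d.
Hypothesis rhoVr : rhoV * rho = 1.
Hypothesis rhorV : rho * rhoV = 1.

Variable sh : {rmorphism DD -> DD}.
Hypothesis shC : forall d, sh (C d) = C (sigma d).
Hypothesis shX : sh h = C rho * h + C b.

(** The endomorphism [theta] extends to [D[h; nu]] so that
    [theta(rho h + b) = h]. For [theta = sigma^-1] this inverts [sigma] on
    [D[h; nu]]; for [theta = tau] it is the twist in [y u = tau(u) y]. *)
Lemma lowering_exists (theta : {rmorphism D -> D}) :
  (forall d, nu (theta d) = theta (sigma (tau d))) ->
  exists th : {rmorphism DD -> DD}, (forall d, th (C d) = C (theta d)) /\
    th h = C (theta rhoV) * (h - C (theta b)).
Proof.
move=> nu_theta.
have [d|th [_ thC thX]] := @skew_lift_exists D nu DD (C \o theta)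
  (C (theta rhoV) * (h - C (theta b))); last by exists th.
rewrite /= -mulrA mulrBl skewXC nu_theta mulrBr !mulrA [RHS]mulrBr -!rmorphM.
have rst c : rhoV * sigma (tau c) = nu c * rhoV by apply: (rhoV_sigma_tau sigma_tau_rho).
by rewrite -[rhoV * b * d]mulrA -sigma_tau_b mulrA !rst.
Qed.

Lemma sigma_h_bijective : bijective sigma ->
  exists sh' : {rmorphism DD -> DD}, cancel sh sh' /\ cancel sh' sh.
Proof.
case=> f fK Kf.
pose iA := GRing.isZmodMorphism.Build D D f (can2_zmod_morphism fK Kf).
pose iM := GRing.isMonoidMorphism.Build D D f (can2_monoid_morphism fK Kf).
pose sigma' : {rmorphism D -> D} := HB.pack_for {rmorphism D -> D} f iA iM.
have sK : cancel sigma sigma' := fK; have Ks : cancel sigma' sigma := Kf.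
have [d|sh' [sh'C sh'X]] := @lowering_exists sigma'; first by rewrite /= Kf fK.
exists sh'; split=> u.
  apply: (@skew_ext _ _ _ (sh' \o sh) idfun) => [d|] /=; first by rewrite shC sh'C sK.
  rewrite shX rmorphD rmorphM !sh'C sh'X mulrA -rmorphM -rmorphM rhorV !rmorph1 mul1r.
  by rewrite subrK.
apply: (@skew_ext _ _ _ (sh \o sh') idfun) => [d|] /=; first by rewrite sh'C shC Ks.
rewrite sh'X rmorphM rmorphB !shC shX !Ks addrK mulrA -rmorphM rhoVr rmorph1.
by rewrite mul1r.
Qed.

(** The element [q] kills the quotient, by the [D[h; nu] q]-valued functions, of
    the weight module indexed by the integers. This quotient is nonzero because
    a monic polynomial of positive degree has no left inverse. *)
Lemma simple_no_normal (q : DD) (N : nat) (u v : D) : bijective sigma ->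
  (0 < N)%N -> scoef q N = 1 -> (forall k, (N < k)%N -> scoef q k = 0) ->
  (forall d, q * C d = C (iter N nu d) * q) -> h * q = q * h ->
  sh q = C u * q -> v * u = 1 -> ~ simple_ring E.
Proof.
move=> sigma_bij N_gt0 qN q_bound qC qX sh_q vu simE.
have [sh' [shK Ksh]] := sigma_h_bijective sigma_bij.
pose G (k : int) : {rmorphism DD -> DD} :=
  match k with Posz n => iter_rmorph sh n | Negz n => iter_rmorph sh' n.+1 end.
have G_next k a : G (k + 1) a = G k (sh a).
  case: k => [n|[|n]]; rewrite /G.
  - by rewrite -PoszD addn1 !iter_rmorphE iterSr.
  - by rewrite /= shK.
  - have -> : Negz n.+1 + 1 = Negz n.
      by rewrite !NegzE [n.+2%:Z]intS opprD addrAC addNr add0r.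
    by rewrite !iter_rmorphE [RHS]iterSr shK.
pose w k := G k h.
pose g k : {rmorphism D -> DD} := (G k \o C : {rmorphism D -> DD}).
pose nextk (k : int) := k + 1; pose prevk (k : int) := k - 1.
have nextK k : prevk (nextk k) = k by rewrite /prevk addrK.
have prevK k : nextk (prevk k) = k \/ w k = 0 by left; rewrite /nextk subrK.
have g_next k d : g (nextk k) d = g k (sigma d) by rewrite /= G_next shC.
have w_next k : w (nextk k) = g k rho * w k + g k b.
  by rewrite /w G_next shX rmorphD rmorphM.
have g_prev k d : w k * g (prevk k) d = g k (tau d) * w k.
  have key j : G (j + 1) h * G j (C d) = G (j + 1) (C (tau d)) * G (j + 1) h.
    rewrite !G_next -[LHS]rmorphM -[RHS]rmorphM shC shX; congr (G _ _).
    rewrite mulrDl mulrDr -mulrA skewXC !mulrA -!rmorphM.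
    by rewrite sigma_tau_b sigma_tau_rho.
  by have := key (prevk k); rewrite subrK.
pose M a := exists c, a = c * q.
have Ml c a : M a -> M (c * a) by case=> c' ->; exists (c * c'); rewrite mulrA.
(* multiplication by q on the left of D[h; nu] is nu^N-twisted *)
have qM a : M (q * a).
  have [d|phi [_ phiC phiX]] := @skew_lift_exists D nu DD (C \o iter_rmorph nu N) h.
    by rewrite /= skewXC !iter_rmorphE -iterS iterSr.
  exists (phi a); apply: (@skew_intertwine D nu DD idfun phi q) => [d|] /=.
    by rewrite phiC /= iter_rmorphE qC.
  by rewrite phiX qX.
have Gq k : exists c, G k q = c * q.
  case: k => [n|n]; rewrite /G.
    elim: n => [|n [c IHn]] /=; first by exists 1; rewrite mul1r.
    by exists (sh c * C u); rewrite IHn rmorphM sh_q mulrA.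
  have sh'q : sh' q = sh' (C v) * q.
    by rewrite -[in RHS](shK q) sh_q -rmorphM mulrA -rmorphM vu rmorph1 mul1r.
  elim: n.+1 => [|m [c IHm]] /=; first by exists 1; rewrite mul1r.
  by exists (sh' c * sh' (C v)); rewrite IHm rmorphM sh'q mulrA.
have subM : submodule nextk prevk g w (fun phi => forall k, M (phi k)).
  split=> // [k|phi psi Mphi Mpsi k|d phi Mphi k|phi Mphi k].
  - by exists 0; rewrite mul0r.
  - have [[c ->] [c' ->]] := (Mphi k, Mpsi k).
    by exists (c - c'); rewrite mulrBl.
  - exact: Ml.
  - exact: Ml.
have subT : submodule nextk prevk g w (fun=> True) by split.
have [s sE] := @word_act_skewpoly _ sigma tau DD _ nextk prevk g w prevK G
  (fun _ _ => erefl) (fun _ => erefl) q.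
have [s0|/(_ (fun=> 1) I 0)[c cq]] :=
  weight_transporter nextK prevK g_next g_prev w_next subT subM simE.
- have: dsk sigma tau b rho s = 0.
    by apply: s0 => phi _ k; rewrite sE; have [c ->] := Gq k; rewrite -mulrA; apply/Ml/qM.
  move/(word_act_eq0 nextK prevK g_next g_prev w_next (fun=> 1)).
  move/(congr1 (fun phi => scoef (phi 0) N)); rewrite sE mulr1 /= qN scoef0.
  by move/eqP; rewrite oner_eq0.
- have c_neq0 : c <> 0.
    by move=> c0; move/eqP: cq; rewrite c0 mul0r oner_eq0.
  have [m [cm c_bound]] := scoef_top c_neq0.
  move/(congr1 (fun a => scoef a (m + N))): cq; rewrite (scoefM_top c_bound q_bound).
  rewrite qN skew_iter1 mulr1 scoef1 addn_eq0 [N == _]eqn0Ngt N_gt0 andbF.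
  by move=> e; apply: cm; rewrite -e.
Qed.

End NormalElements.

(** * Binomial coefficients modulo a prime *)

Lemma bin_mul_bin j i l :
  ('C(j + i, i) * 'C(j, l) = 'C(j + i, l + i) * 'C(l + i, i))%N.
Proof.
have [le_lj|lt_jl] := leqP l j; last first.
  by rewrite (bin_small lt_jl) muln0 bin_small ?mul0n // ltn_add2r.
apply/eqP; rewrite -(eqn_pmul2r (fact_gt0 i)) -(eqn_pmul2r (fact_gt0 l)).
rewrite -(eqn_pmul2r (fact_gt0 (j - l))); apply/eqP.
have e1 := bin_fact (leq_addl j i); have e2 := bin_fact le_lj.
have e3 : (l + i <= j + i)%N by rewrite leq_add2r.
have {}e3 := bin_fact e3; have e4 := bin_fact (leq_addl l i).
rewrite addnK in e1; rewrite subnDr in e3; rewrite addnK in e4.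
transitivity (j + i)`!%N.
  rewrite -e1 -e2; by rewrite -!mulnA; congr (_ * _)%N; rewrite mulnCA; congr (_ * _)%N.
by rewrite -e3 -e4 !mulnA.
Qed.

Lemma dvdn_bin_pow p a j : prime p -> (0 < j < p ^ a)%N -> (p %| 'C(p ^ a, j))%N.
Proof.
move=> p_prime /andP[j_gt0 lt_j]; case: j j_gt0 lt_j => // j _ lt_j.
apply: contraLR lt_j => p_ndvd; rewrite -leqNgt dvdn_leq //.
rewrite -(@Gauss_dvdl _ _ 'C(p ^ a, j.+1)); last first.
  by rewrite coprimeXl // prime_coprime.
by rewrite -mul_bin_diag dvdn_mulr.
Qed.

(** Vandermonde's convolution, whose inner terms vanish modulo [p]. *)
Lemma bin_pow_mul p a q : prime p -> ('C(p ^ a * q, p ^ a) = q %[mod p])%N.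
Proof.
move=> p_prime; have pa_gt0 : (0 < p ^ a)%N by rewrite expn_gt0 prime_gt0.
elim: q => [|q IHq]; first by rewrite muln0 bin_small.
rewrite mulnS -binomial.Vandermonde big_ord_recl bin0 mul1n subn0 -modnDml IHq.
have: forall j, (0 < j < p ^ a)%N -> (p %| 'C(p ^ a, j))%N.
  by move=> j; apply: dvdn_bin_pow.
case: (p ^ a)%N pa_gt0 {IHq} => // N _ dvd_bin.
rewrite big_ord_recr /= subnn bin0 muln1 [bump 0 N]add1n binn.
have /dvdnP[t ->] :
    (p %| \sum_(i < N) 'C(N.+1, bump 0 i) * 'C(N.+1 * q, N.+1 - bump 0 i))%N.
  by apply: dvdn_sum => i _; rewrite dvdn_mulr // dvd_bin //= ltnS.
by rewrite addnCA modnMDl modnDml addn1.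
Qed.

(** If [j = p^a q] with [p] not dividing [q > 1], then ['C(j, p^a)] is [q]
    modulo [p]. *)
Lemma prime_power_of_bin p j : prime p -> (0 < j)%N ->
  (forall i, (0 < i < j)%N -> (p %| 'C(j, i))%N) -> exists a, j = (p ^ a)%N.
Proof.
move=> p_prime j_gt0 dvd_bin; have [q p_q jE] := pfactor_coprime p_prime j_gt0.
move: (logn p j) jE => a jE; exists a; move: dvd_bin j_gt0; rewrite {j}jE mulnC.
have pa_gt0 : (0 < p ^ a)%N by rewrite expn_gt0 prime_gt0.
move=> dvd_bin; rewrite muln_gt0 pa_gt0 /= => q_gt0.
have [lt_1q|] := ltnP 1 q; last first.
  by case: q q_gt0 {p_q dvd_bin} => [|[|]] // _ _; rewrite muln1.
have /dvd_bin : (0 < p ^ a < p ^ a * q)%N by rewrite pa_gt0 -[ltnLHS]muln1 ltn_pmul2l.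
rewrite /dvdn bin_pow_mul // -/(dvdn p q).
by move: p_q; rewrite prime_coprime // => /negPf->.
Qed.

(** * Semi-invariant coefficient families *)

Lemma nat_least (P : nat -> Prop) : (exists n, P n) ->
  exists n, P n /\ forall m, P m -> (n <= m)%N.
Proof.
move=> exP; have exb : exists n, `[< P n >] by case: exP => n Pn; exists n; apply/asboolP.
by exists (ex_minn exb); case: ex_minnP => n /asboolP Pn minn; split=> // m /asboolP/minn.
Qed.

Section SemiInvariants.
Variables (D : nzRingType) (sigma tau : {rmorphism D -> D}) (b rho rhoV : D).
Local Notation nu := (diskew_nu sigma tau).
Local Notation r := (rho_nu sigma tau rho).
Implicit Types (beta : nat -> D) (k l m : nat).

Hypothesis rhoVr : rhoV * rho = 1.
Hypothesis rhorV : rho * rhoV = 1.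
Hypothesis nu_epi : forall d, exists d', nu d' = d.

Lemma rho_nu0 : r 0 = 1.
Proof. by rewrite /rho_nu big_geq. Qed.

Lemma rho_nu1 : r 1 = rho.
Proof. by rewrite /rho_nu big_nat1. Qed.

Lemma rho_nuS m : r m.+1 = r m * iter m nu rho.
Proof. by rewrite /rho_nu big_nat_recr. Qed.

Lemma rho_nuD m n : r (m + n) = r m * iter m nu (r n).
Proof.
elim: n => [|n IHn]; first by rewrite addn0 rho_nu0 skew_iter1 mulr1.
by rewrite addnS !rho_nuS IHn skew_iterM -iterD mulrA.
Qed.

Lemma rho_nu_unit m : is_unit (r m).
Proof.
elim: m => [|m [v [vr rv]]]; first by exists 1; rewrite rho_nu0 mulr1.
exists (iter m nu rhoV * v); rewrite rho_nuS -!mulrA (mulrA v) vr mul1r.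
by rewrite (mulrA (iter m nu rho)) -!skew_iterM rhoVr rhorV !skew_iter1 mul1r.
Qed.

(** If [f] has coefficients [beta] then [sigma(f) = f(rho h + b)] has
    [taylor k beta m * r m] as coefficient of [h^m]. *)
Definition taylor k beta m : D :=
  \sum_(j < k.+1) (sigma (beta j) * b ^+ (j - m)) *+ 'C(j, m).

(** The coefficients, up to degree [k], of a polynomial [f] in [h] that is
    normalised like [h^k]: [f d = nu^k(d) f], [h f = f h] and
    [sigma(f) = rho^nu_k f]. In the last equation the factors [r m] that
    [sigma(f)] brings in have been cancelled on both sides. *)
Definition semi_invariant k beta : Prop :=
  [/\ forall j d, (j <= k)%N -> beta j * d = iter (k - j) nu d * beta j,
      forall j, (j <= k)%N -> nu (beta j) = beta j
    & forall m, (m <= k)%N -> taylor k beta m = r (k - m)%N * beta m].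

(** These are the coefficients of a divided derivative: semi-invariance is
    inherited because ['C(j, i) 'C(j - i, m) = 'C(j, m + i) 'C(m + i, i)]. *)
Lemma semi_invariant_hasse k beta i : (i <= k)%N -> semi_invariant k beta ->
  semi_invariant (k - i) (fun l => beta (l + i)%N *+ 'C(l + i, i)).
Proof.
move=> le_ik [beta_comm beta_nu beta_taylor].
have bound j : (j <= k - i)%N -> (j + i <= k)%N by rewrite leq_subRL // addnC.
split=> [j d le_j|j le_j|m le_m].
- by rewrite mulrnAl mulrnAr beta_comm ?bound // addnC subnDA.
- by rewrite rmorphMn beta_nu // bound.
- rewrite -subnDA (addnC i) mulrnAr -beta_taylor ?bound //.
  rewrite /taylor -[in RHS](subnK le_ik) -addSn addnC big_split_ord /=.
  rewrite [X in _ = (X + _) *+ _]big1 ?add0r => [|j _]; last first.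
    by rewrite bin_small ?mulr0n // (leq_trans (ltn_ord j)) // leq_addl.
  rewrite -sumrMnl; apply: eq_bigr => j _.
  by rewrite rmorphMn mulrnAl -!mulrnA (addnC i j) subnDr bin_mul_bin.
Qed.

Hypothesis simD : endo_simple sigma.

(** Both hypotheses on [c] serve to make [D c] a [sigma]-stable ideal. *)
Lemma semi_invariant_unit n (c u : D) : (forall d, c * d = iter n nu d * c) ->
  sigma c = u * c -> c <> 0 -> is_unit c.
Proof.
move=> c_comm c_sigma c_neq0.
have [|d [e ->]|I0|/(_ 1)[e ec]] := simD (I := fun d => exists e, d = e * c).
- split=> [|d d' [e ->] [e' ->]|a d [e ->]]; first by exists 0; rewrite mul0r.
    by exists (e - e'); rewrite mulrBl.
  split; first by exists (a * e); rewrite mulrA.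
  by exists (e * iter n nu a); rewrite -!mulrA c_comm.
- by exists (sigma e * u); rewrite rmorphM c_sigma mulrA.
- by case: c_neq0; apply: I0; exists 1; rewrite mul1r.
- exists e; split=> //; have [e' e'E] := iter_onto n nu_epi e.
  have ce' : c * e' = 1 by rewrite c_comm e'E.
  by have -> : e = e' by rewrite -[e]mulr1 -ce' mulrA -ec mul1r.
Qed.

(** Dividing by a leading coefficient, which is a unit. *)
Lemma semi_invariant_monic k beta l : (l <= k)%N -> semi_invariant k beta ->
  beta l <> 0 -> (forall j, (l < j <= k)%N -> beta j = 0) ->
  exists beta', semi_invariant l beta' /\ beta' l = 1.
Proof.
move=> le_lk [beta_comm beta_nu beta_taylor] beta_l beta_bound.
have taylorE m : taylor k beta m = taylor l beta m.
  rewrite /taylor -(subnKC le_lk) -addSn big_split_ord /= [X in _ + X]big1 ?addr0 // => j _.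
  have lt_j : (l < l.+1 + j <= k)%N by rewrite leq_addr addSn -ltn_subRL ltn_ord.
  by rewrite beta_bound ?rmorph0 ?mul0r ?mul0rn.
set c := beta l in beta_l.
have c_comm d : c * d = iter (k - l) nu d * c by apply: beta_comm.
have c_sigma : sigma c = r (k - l)%N * c.
  rewrite -beta_taylor // taylorE /taylor big_ord_recr /= subnn mulr1 binn.
  by rewrite big1 ?add0r // => j _; rewrite bin_small.
have [e [ec ce]] := semi_invariant_unit c_comm c_sigma beta_l.
have e_comm d : e * iter (k - l) nu d = d * e.
  by rewrite -[LHS]mulr1 -ce mulrA -(mulrA e) -c_comm mulrA ec mul1r.
have nu_e : nu e = e.
  have nu_c : nu c = c by apply: beta_nu.
  by rewrite -[LHS]mulr1 -ce mulrA -[X in _ * X * _]nu_c -rmorphM ec rmorph1 mul1r.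
exists (fun j => e * beta j); split=> //.
split=> [j d le_jl|j le_jl|m le_ml].
- rewrite -mulrA beta_comm ?(leq_trans le_jl) // !mulrA -e_comm -iterD.
  by rewrite addnBA // subnK.
- by rewrite rmorphM nu_e beta_nu // (leq_trans le_jl).
- transitivity (sigma e * taylor k beta m).
    rewrite taylorE /taylor mulr_sumr; apply: eq_bigr => j _.
    by rewrite rmorphM mulrnAr mulrA.
  rewrite beta_taylor ?(leq_trans le_ml) // !mulrA; congr (_ * _).
  have key : sigma c * r (l - m)%N = r (k - m)%N * c.
    rewrite c_sigma -mulrA c_comm mulrA -rho_nuD; congr (r _ * _).
    by rewrite addnBA // subnK.
  rewrite -[LHS]mulr1 -ce !mulrA -(mulrA _ _ c) -key !mulrA -rmorphM ec.
  by rewrite rmorph1 mul1r.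
Qed.

Variable p : nat.
Hypothesis p_prime : prime p.
Hypothesis pcharD : p \in [pchar D].

(** In minimal positive degree all divided derivatives are constant, because a
    nonconstant one would have smaller degree; so ['C(j, i) * beta j = 0] for
    [0 < i < j], and only [p]-powers [j] survive. *)
Lemma semi_invariant_additive :
  (exists k, (0 < k)%N /\ exists beta, semi_invariant k beta /\ beta k = 1) ->
  exists n beta, [/\ semi_invariant (p ^ n) beta, beta (p ^ n)%N = 1
    & forall j, (0 < j < p ^ n)%N -> beta j <> 0 -> exists2 a, (a < n)%N & j = (p ^ a)%N].
Proof.
move/nat_least=> [k [[k_gt0 [beta [beta_inv beta_k]]] k_min]].
have hasse0 i l : (0 < i)%N -> (0 < l)%N -> (l + i <= k)%N ->
    beta (l + i)%N *+ 'C(l + i, i) = 0.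
  move=> i_gt0 l_gt0 le_k; have le_ik : (i <= k)%N by apply: leq_trans le_k; rewrite leq_addl.
  have hasse_inv := semi_invariant_hasse le_ik beta_inv.
  set gamma := (fun l => _) in hasse_inv.
  have [//|gamma_l] := pselect (gamma l = 0).
  (* the top nonzero coefficient of the derivative, counted from [k - i] down *)
  have [|j [[le_j gamma_j] j_min]] := @nat_least (fun j => (j < k - i)%N /\ gamma (k - i - j)%N <> 0).
    exists (k - i - l)%N; have -> : (k - i - (k - i - l) = l)%N by lia.
    by split=> //; lia.
  have := semi_invariant_monic (leq_subr j (k - i)) hasse_inv gamma_j.
  case=> [t /andP[lt_t le_t]|beta' beta'P].
    have [//|gamma_t] := pselect (gamma t = 0).
    have /j_min : (k - i - t < k - i)%N /\ gamma (k - i - (k - i - t))%N <> 0.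
      have -> : (k - i - (k - i - t) = t)%N by lia.
      by split=> //; lia.
    by lia.
  have /k_min : (0 < k - i - j)%N /\ exists beta,
      semi_invariant (k - i - j) beta /\ beta (k - i - j)%N = 1.
    by rewrite subn_gt0; split=> //; exists beta'.
  by lia.
have pow j : (0 < j <= k)%N -> beta j <> 0 -> exists a, j = (p ^ a)%N.
  case/andP=> j_gt0 le_jk beta_j; apply: prime_power_of_bin => // i /andP[i_gt0 lt_ij].
  have := hasse0 i (j - i)%N i_gt0.
  rewrite subn_gt0 (subnK (ltnW lt_ij)) => /(_ lt_ij le_jk).
  have [//|p_ndvd] := boolP (p %| 'C(j, i))%N; rewrite -prime_coprime // in p_ndvd.
  have bin_gt0 : (0 < 'C(j, i))%N by rewrite bin_gt0 ltnW.
  have [u v uv _] := egcdnP p bin_gt0.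
  move/(congr1 (fun d => d *+ u)); rewrite mul0rn -mulrnA mulnC uv.
  rewrite gcdnC (eqP p_ndvd) mulrnDr mulrnA [_ *+ p]mulrn_pchar // add0r.
  by move/beta_j.
have [n kE] := pow k (introT andP (conj k_gt0 (leqnn k))) (eq_ind_r (fun d => d <> 0) (elimN eqP (oner_neq0 D)) beta_k).
exists n, beta; rewrite -kE; split=> // j /andP[j_gt0 lt_jk] beta_j.
have [|a jE] := pow j _ beta_j; first by rewrite j_gt0 ltnW.
by exists a => //; move: lt_jk; rewrite jE kE ltn_exp2l // prime_gt1.
Qed.

End SemiInvariants.

(** * Semi-invariant polynomials *)

Lemma sum_pow_support (D : nzRingType) (F : nat -> D) p n : prime p ->
  (forall j, (0 < j < p ^ n)%N -> F j <> 0 -> exists2 a, (a < n)%N & j = (p ^ a)%N) ->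
  \sum_(j < (p ^ n)%N) F j = F 0%N + \sum_(i < n) F (p ^ i)%N.
Proof.
move=> p_prime; have p_gt1 := prime_gt1 p_prime.
elim: n => [|n IHn] Fsupp; first by rewrite expn0 big_ord1 big_ord0 addr0.
have pn_gt0 : (0 < p ^ n)%N by rewrite expn_gt0 prime_gt0.
have lt_pn : (p ^ n < p ^ n.+1)%N by rewrite ltn_exp2l.
rewrite big_ord_recr /= addrA -IHn; last first.
  move=> j /andP[j_gt0 lt_j] /Fsupp[|a _ jE]; first by rewrite j_gt0 (ltn_trans lt_j).
  by exists a => //; move: lt_j; rewrite jE ltn_exp2l.
rewrite -!(big_mkord xpredT F) (big_cat_nat (n := p ^ n)) //=; last exact: ltnW.
rewrite [X in _ + X]big_ltn // [X in _ + (_ + X)]big1_seq ?addr0 // => j.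
rewrite mem_index_iota => /andP[_ /andP[lt_j lt_j']].
apply: contrapT => /Fsupp[|a lt_an jE].
  by rewrite lt_j' (leq_ltn_trans _ lt_j).
by move: lt_j; rewrite jE ltn_exp2l // ltnNge -ltnS lt_an.
Qed.

Section SemiInvariantPolynomials.
Variables (D : nzRingType) (sigma tau : {rmorphism D -> D}) (b rho rhoV : D).
Local Notation nu := (diskew_nu sigma tau).
Local Notation r := (rho_nu sigma tau rho).
Local Notation DD := (skewpoly nu).
Local Notation C := (skewC nu).
Local Notation h := (skewX nu).

Hypothesis sigma_tau_rho : forall d : D, sigma (tau d) * rho = rho * tau (sigma d).
Hypothesis sigma_tau_b : forall d : D, sigma (tau d) * b = b * d.
Hypothesis rhoVr : rhoV * rho = 1.
Hypothesis rhorV : rho * rhoV = 1.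
Hypothesis b_unit : is_unit b.

Variable sh : {rmorphism DD -> DD}.
Hypothesis shC : forall d, sh (C d) = C (sigma d).
Hypothesis shX : sh h = C rho * h + C b.

(** As [b] is a unit, [sigma tau] fixes it, so [rho h] and [b] commute. *)
Lemma b_rho_comm : b * rho = rho * nu b.
Proof.
have [c [cb bc]] := b_unit.
have stb : sigma (tau b) = b by rewrite -[LHS]mulr1 -bc mulrA sigma_tau_b -mulrA bc mulr1.
by rewrite -[in LHS]stb sigma_tau_rho.
Qed.

Lemma rho_h_exp j : (C rho * h) ^+ j = C (r j) * h ^+ j.
Proof.
elim: j => [|j IHj]; first by rewrite rho_nu0 rmorph1 mul1r.
rewrite exprSr IHj -mulrA (mulrA _ (C rho)) skewXnC -mulrA -exprSr mulrA -rmorphM.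
by rewrite -rho_nuS.
Qed.

Lemma scoef_sigma_h_exp j l : scoef (sh (h ^+ j)) l = (b ^+ (j - l) * r l) *+ 'C(j, l).
Proof.
have comm_b : GRing.comm (C b) (C rho * h).
  by rewrite /GRing.comm -[RHS]mulrA skewXC !mulrA -!rmorphM b_rho_comm.
rewrite rmorphXn shX addrC exprDn_comm // scoef_sum.
under eq_bigr => i _.
  rewrite rho_h_exp -rmorphXn mulrA -rmorphM -mulrnAl -rmorphMn scoefCM scoefXn.
  over.
have [lt_lj|le_jl] := ltnP l j.+1; last first.
  rewrite bin_small // mulr0n big1 // => i _.
  by rewrite gtn_eqF ?mulr0 // (leq_trans (ltn_ord i)).
rewrite (bigD1 (Ordinal lt_lj)) //= eqxx mulr1 big1 ?addr0 // => i.
by rewrite -val_eqE /= eq_sym => /negPf->; rewrite mulr0.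
Qed.

Lemma scoef_sigma_h k f l : (forall j, (k < j)%N -> scoef f j = 0) ->
  scoef (sh f) l = taylor sigma b k (scoef f) l * r l.
Proof.
move=> /skewpoly_expand {1}->; rewrite rmorph_sum scoef_sum /taylor mulr_suml.
apply: eq_bigr => j _; rewrite rmorphM shC scoefCM scoef_sigma_h_exp.
by rewrite mulrnAr mulrnAl mulrA.
Qed.

Lemma semi_invariant_poly k f : (forall d, exists d', nu d' = d) ->
  (forall j, (k < j)%N -> scoef f j = 0) ->
  (forall d, f * C d = C (iter k nu d) * f) -> sh f = C (r k) * f ->
  h * f = f * h -> semi_invariant sigma tau b rho k (scoef f).
Proof.
move=> nu_epi f_bound fC sh_f fX.
have f_comm j d : (j <= k)%N -> scoef f j * d = iter (k - j) nu d * scoef f j.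
  move=> le_jk; have [e <-] := iter_onto j nu_epi d.
  have /(congr1 (fun g => scoef g j)) := fC e.
  by rewrite scoefMC scoefCM -iterD subnK.
split=> // [j _|m le_mk].
  by have /(congr1 (fun g => scoef g j.+1)) := fX; rewrite scoefXM scoefMX.
have [v [vr rv]] := rho_nu_unit sigma tau rhoVr rhorV m.
have /(congr1 (fun g => scoef g m)) := sh_f; rewrite (scoef_sigma_h _ f_bound) scoefCM.
rewrite -[in r k](subnK le_mk) rho_nuD -mulrA -f_comm // mulrA.
by move/(congr1 (fun d => d * v)); rewrite -!mulrA rv !mulr1.
Qed.

Variable p : nat.
Hypothesis p_prime : prime p.
Hypothesis pcharD : p \in [pchar D].

Lemma mulrn_bin_pow (d : D) a j : (0 < j < p ^ a)%N -> d *+ 'C(p ^ a, j) = 0.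
Proof.
by move=> /(dvdn_bin_pow p_prime) /dvdnP[t ->]; rewrite mulrnA mulrn_pchar.
Qed.

Lemma sigma_h_pow a : sh (h ^+ (p ^ a)) = C (r (p ^ a)%N) * h ^+ (p ^ a) + C (b ^+ (p ^ a)).
Proof.
apply: scoefP => l; rewrite scoef_sigma_h_exp scoefD scoefCM scoefXn scoefC.
have pa_gt0 : (0 < p ^ a)%N by rewrite expn_gt0 prime_gt0.
have [->|l_neq0] := eqVneq l 0%N.
  by rewrite subn0 rho_nu0 bin0 !mulr1 eq_sym -[_ == _]negbK -lt0n pa_gt0 mulr0 add0r.
have [lt_l|gt_l|->] := ltngtP l (p ^ a)%N; rewrite ?mulr0 ?addr0.
- by rewrite mulrn_bin_pow // lt0n l_neq0.
- by rewrite bin_small.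
- by rewrite subnn binn mul1r mulr1.
Qed.

(** Semi-invariance of [h^(p^n) + sum_i alpha_i h^(p^i) + alpha], spelled out on
    its coefficients; [n = 0] is the case of degree one. *)
Definition additive_obstruction n (alpha : D) (alpha_ : 'I_n -> D) : Prop :=
  [/\ forall d : D,
        alpha * d = iter (p ^ n) nu d * alpha /\
        (forall i : 'I_n, alpha_ i * d = iter (p ^ n - p ^ i) nu d * alpha_ i),
      (forall i : 'I_n, sigma (alpha_ i) = r (p ^ n - p ^ i)%N * alpha_ i) /\
      r (p ^ n)%N * alpha - sigma alpha =
        b ^+ (p ^ n) + \sum_(i < n) sigma (alpha_ i) * b ^+ (p ^ i)
    & nu alpha = alpha /\ (forall i : 'I_n, nu (alpha_ i) = alpha_ i)].

(** As the binomials ['C(p^a, j)] with [0 < j < p^a] vanish in [D], the expansion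
    of [sigma(f)] has a single term in each positive degree. *)
Lemma semi_invariant_obstruction n (beta : nat -> D) :
  semi_invariant sigma tau b rho (p ^ n) beta -> beta (p ^ n)%N = 1 ->
  (forall j, (0 < j < p ^ n)%N -> beta j <> 0 -> exists2 a, (a < n)%N & j = (p ^ a)%N) ->
  additive_obstruction (beta 0%N) (fun i : 'I_n => beta (p ^ i)%N).
Proof.
move=> [beta_comm beta_nu beta_taylor] beta_pn beta_supp.
have le_pow (i : 'I_n) : (p ^ i < p ^ n)%N by rewrite ltn_exp2l // prime_gt1.
split=> [d||].
- split=> [|i]; first by rewrite beta_comm // subn0.
  by rewrite beta_comm // ltnW.
- split=> [i|].
    rewrite -beta_taylor; last exact: ltnW.
    have lt_i : (p ^ i < (p ^ n).+1)%N by rewrite ltnW // ltnS.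
    rewrite /taylor (bigD1 (Ordinal lt_i)) //= subnn mulr1 binn big1 ?addr0 // => j.
    rewrite -val_eqE /= neq_ltn => /orP[lt_ji|lt_ij]; first by rewrite bin_small.
    have [jE|lt_j] := eqVneq (nat_of_ord j) (p ^ n)%N.
      by rewrite jE mulrn_bin_pow // expn_gt0 prime_gt0 //= -jE.
    have [->|/beta_supp[|a _ jE]] := pselect (beta j = 0).
    + by rewrite rmorph0 mul0r mul0rn.
    + by rewrite (leq_trans _ lt_ij) //= ltn_neqAle lt_j -ltnS ltn_ord.
    + by rewrite jE mulrn_bin_pow // expn_gt0 prime_gt0 //= -jE.
  have := beta_taylor 0%N isT; rewrite subn0 => <-.
  rewrite /taylor big_ord_recr /= beta_pn rmorph1 mul1r subn0 bin0 mulr1n.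
  rewrite (@sum_pow_support _ (fun j => (sigma (beta j) * b ^+ (j - 0)) *+ 'C(j, 0)) p n) //.
    rewrite expr0 mulr1 bin0 mulr1n addrAC (addrAC _ _ (- _)) subrr add0r addrC.
    by congr (_ + _); apply: eq_bigr => i _; rewrite subn0 bin0.
  move=> j /beta_supp supp_j F_j; apply: supp_j => bj0; apply: F_j.
  by rewrite bj0 rmorph0 mul0r mul0rn.
- by split=> [|i]; apply: beta_nu => //; apply: ltnW.
Qed.

(** Conversely, these coefficients give a polynomial that is normal in [E]. *)
Lemma obstruction_normal n alpha (alpha_ : 'I_n -> D) :
  additive_obstruction alpha alpha_ ->
  let q := h ^+ (p ^ n) + \sum_(i < n) C (alpha_ i) * h ^+ (p ^ i) + C alpha in
  [/\ forall d, q * C d = C (iter (p ^ n) nu d) * q, sh q = C (r (p ^ n)%N) * q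
    & h * q - q * h = 0].
Proof.
move=> [a_comm [a_sigma a_eq] [a_nu a_nu_]] q.
have le_pow (i : 'I_n) : (p ^ i <= p ^ n)%N by rewrite leq_exp2l ?prime_gt1 // ltnW.
split=> [d||].
- rewrite /q !mulrDl !mulrDr skewXnC -[C alpha * _]rmorphM -[_ * C alpha]rmorphM (a_comm d).1.
  congr (_ + _ + _).
  rewrite mulr_suml mulr_sumr; apply: eq_bigr => i _.
  rewrite -mulrA skewXnC !mulrA -[C (alpha_ i) * _]rmorphM (a_comm _).2 -iterD.
  by rewrite subnK // rmorphM.
- have a_sum : sigma alpha + b ^+ (p ^ n) + \sum_(i < n) sigma (alpha_ i) * b ^+ (p ^ i)
      = r (p ^ n)%N * alpha.
    by rewrite -addrA -a_eq addrC subrK.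
  rewrite /q !mulrDr -[C _ * C alpha]rmorphM -a_sum !rmorphD rmorph_sum sigma_h_pow shC.
  rewrite mulr_sumr rmorph_sum.
  have -> : \sum_(i < n) sh (C (alpha_ i) * h ^+ (p ^ i)) =
      \sum_(i < n) C (r (p ^ n)%N) * (C (alpha_ i) * h ^+ (p ^ i)) +
      \sum_(i < n) C (sigma (alpha_ i) * b ^+ (p ^ i)).
    rewrite -big_split; apply: eq_bigr => i _ /=.
    rewrite rmorphM shC sigma_h_pow mulrDr !mulrA -!rmorphM a_sigma -mulrA (a_comm _).2.
    by rewrite mulrA -rho_nuD subnK.
  rewrite -!addrA; congr (_ + _); rewrite addrCA; congr (_ + _).
  by rewrite addrA addrC.
- apply/eqP; rewrite subr_eq0; apply/eqP.
  rewrite /q !mulrDl !mulrDr -exprS -exprSr skewXC a_nu; congr (_ + _ + _).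
  rewrite mulr_suml mulr_sumr; apply: eq_bigr => i _.
  by rewrite mulrA skewXC a_nu_ -!mulrA -exprS -exprSr.
Qed.

End SemiInvariantPolynomials.

(** * Ideals of the skew polynomial ring in [x] over [D[h; nu]] *)

Section SaturatedIdeals.
Variables (D : nzRingType) (sigma tau : {rmorphism D -> D}) (b rho rhoV : D).
Local Notation nu := (diskew_nu sigma tau).
Local Notation r := (rho_nu sigma tau rho).
Local Notation DD := (skewpoly nu).
Local Notation C := (skewC nu).
Local Notation h := (skewX nu).

Hypothesis sigma_tau_rho : forall d : D, sigma (tau d) * rho = rho * tau (sigma d).
Hypothesis sigma_tau_b : forall d : D, sigma (tau d) * b = b * d.
Hypothesis rhoVr : rhoV * rho = 1.
Hypothesis rhorV : rho * rhoV = 1.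
Hypothesis nu_epi : forall d, exists d', nu d' = d.
Hypothesis simD : endo_simple sigma.
Hypothesis b_unit : forall i, (1 <= i)%N -> is_unit (b_seq sigma b rho i).

Variable sh : {rmorphism DD -> DD}.
Hypothesis shC : forall d, sh (C d) = C (sigma d).
Hypothesis shX : sh h = C rho * h + C b.

Let b1_unit : is_unit b. Proof. by rewrite -(b_seq1 sigma b rho); apply: b_unit. Qed.

Lemma sigma_h_iterE i : (0 < i)%N ->
  iter i sh h = C (a_seq sigma rho i) * h + C (b_seq sigma b rho i).
Proof.
case: i => // i _; elim: i => [|i IHi].
  by rewrite /= shX /a_seq /b_seq big_nat1 big_geq // add0r.
rewrite iterS IHi rmorphD rmorphM !shC shX (a_seqS sigma rho i.+1) (@b_seqS _ sigma b rho i.+1) //.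
by rewrite mulrDr mulrA -!rmorphM -addrA -(rmorphD C).
Qed.

(** Modulo the left ideal generated by [h], [sigma^m(h)] is the unit [b_m];
    comparing coefficients of [h^j] for increasing [j] makes those of [q] vanish
    in turn. *)
Lemma sigma_h_twist_eq0 m (q : DD) : (0 < m)%N -> q * iter m sh h = h * q -> q = 0.
Proof.
move=> m_gt0; rewrite sigma_h_iterE // mulrDr mulrA => qE.
have [v [_ bv]] := b_unit m_gt0.
have cancel_b j : scoef q j * iter j nu (b_seq sigma b rho m) = 0 -> scoef q j = 0.
  move/(congr1 (fun d => d * iter j nu v)).
  by rewrite -mulrA -skew_iterM bv skew_iter1 mulr1 mul0r.
apply: scoefP => j; rewrite scoef0; elim: j => [|j IHj]; apply: cancel_b.
  have /(congr1 (fun g => scoef g 0)) := qE.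
  by rewrite scoefD scoefMX scoefMC scoefXM add0r.
have /(congr1 (fun g => scoef g j.+1)) := qE.
by rewrite scoefD scoefMX !scoefMC scoefXM IHj rmorph0 mul0r add0r.
Qed.

Lemma b_rho_nu_comm k : b * r k = r k * iter k nu b.
Proof.
elim: k => [|k IHk]; first by rewrite rho_nu0 mulr1 mul1r.
rewrite rho_nuS mulrA IHk -!mulrA -!skew_iterM.
by rewrite (b_rho_comm sigma_tau_rho sigma_tau_b b1_unit) skew_iterM iterSr.
Qed.

Lemma scoef_cancel k (f : DD) c c' : scoef f k = 1 -> C c * f = C c' * f -> c = c'.
Proof.
by move=> fk /(congr1 (fun g => scoef g k)); rewrite !scoefCM fk !mulr1.
Qed.

(** The defect [e] is normal and semi-invariant, hence zero or a unit; a unit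
    would make the coefficients of [f] vanish in turn. *)
Lemma semi_invariant_commutes k (f : DD) e : scoef f k = 1 ->
  (forall d, f * C d = C (iter k nu d) * f) -> sh f = C (r k) * f ->
  f * h = (h + C e) * f -> e = 0.
Proof.
move=> fk fC sh_f fX; have [//|e_neq0] := pselect (e = 0).
have e_comm d : e * d = iter 1 nu d * e.
  have [c <-] := iter_onto k nu_epi d; apply: (scoef_cancel fk); rewrite -iterS iterSr.
  have: (h + C e) * (C (iter k nu c) * f) = C (iter k.+1 nu c) * ((h + C e) * f).
    by rewrite -fX -fC mulrA -fX iterSr (mulrA _ f) -fC -!mulrA skewXC.
  rewrite mulrDl [in RHS]mulrDl (mulrA h) skewXC -iterS -mulrA mulrDr => /addrI.
  by rewrite !mulrA -!rmorphM iterSr.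
have [v [vr rv]] := rho_nu_unit sigma tau rhoVr rhorV k.
have e_sigma : sigma e = r k.+1 * nu v * e.
  suff e_r : r k.+1 * e = sigma e * r k.
    by rewrite -mulrA -[nu v](erefl (iter 1 nu v)) -e_comm mulrA e_r -mulrA rv mulr1.
  apply: (scoef_cancel fk); have: sh f * sh h = sh (h + C e) * sh f by rewrite -!rmorphM fX.
  rewrite (rmorphD sh) shC shX sh_f.
  have -> : C (r k) * f * (C rho * h + C b) =
      C (r k.+1) * h * f + C (r k.+1 * e) * f + C (r k * iter k nu b) * f.
    rewrite mulrDr -!mulrA fC (mulrA f) fC -!mulrA fX !mulrA -!rmorphM -rho_nuS.
    by rewrite mulrDr mulrDl -rmorphM.
  have -> : (C rho * h + C b + C (sigma e)) * (C (r k) * f) =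
      C (r k.+1) * h * f + C (r k * iter k nu b) * f + C (sigma e * r k) * f.
    rewrite !mulrDl !mulrA -!rmorphM b_rho_nu_comm -(mulrA _ h) skewXC mulrA -rmorphM.
    by rewrite -[k.+1]add1n rho_nuD rho_nu1.
  by rewrite addrAC => /addrI.
have [u [ue _]] := semi_invariant_unit nu_epi simD e_comm e_sigma e_neq0.
have fE j : scoef f j = 0.
  have cancel_e d : e * d = 0 -> d = 0.
    by move/(congr1 (fun c => u * c)); rewrite mulrA ue mul1r mulr0.
  elim: j => [|j IHj]; apply: cancel_e.
    have /(congr1 (fun g => scoef g 0)) := fX.
    by rewrite mulrDl scoefD scoefMX scoefCM scoefXM add0r => <-.
  have /(congr1 (fun g => scoef g j.+1)) := fX.
  by rewrite mulrDl scoefD scoefMX scoefCM scoefXM IHj rmorph0 add0r => <-.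
by move/eqP: fk; rewrite fE eq_sym oner_eq0.
Qed.

(** Take [u] in [J] of least degree in [x] and, next, with constant term [f] of
    least degree [k] in [h]. The leading coefficients of such [f] form
    a [sigma]-stable ideal of [D], so [f] may be taken monic. By minimality
    [u d - nu^k(d) u], [sigma(u) - rho^nu_k u] and [u h - (h + e) u] vanish;
    this makes [f] a semi-invariant polynomial, so [k = 0] and [f = 1]. The last
    equation now reads [u_m sigma^m(h) = h u_m] on the coefficient of [x^m], which
    is therefore zero for [m > 0]. *)
Lemma saturated_ideal_unit (J : skewpoly sh -> Prop) :
  (forall k f, (forall j, (k < j)%N -> scoef f j = 0) -> scoef f k = 1 ->
    (forall d, f * C d = C (iter k nu d) * f) -> sh f = C (r k) * f ->
    h * f = f * h -> k = 0%N) ->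
  two_sided_ideal J -> (forall u, J (u * skewX sh) -> J u) ->
  (exists u, J u /\ u <> 0) -> J 1.
Proof.
move=> no_inv [J0 JB JM] Jsat exJ; pose CA := skewC sh; pose x := skewX sh.
pose xdeg n (u : skewpoly sh) := forall i, (n < i)%N -> scoef u i = 0.
pose P n := exists u : skewpoly sh, [/\ J u, u <> 0 & xdeg n u].
have [|m [[u0 [Ju0 u0_neq0 u0_bound]] m_min]] := @nat_least P.
  by case: exJ => u [Ju u_neq0]; have [n [_ u_bound]] := scoef_top u_neq0; exists n, u.
(* minimality of [m] and saturation keep constant terms nonzero *)
have const_neq0 u : J u -> xdeg m u -> scoef u 0 = 0 -> u = 0.
  move=> Ju um u00; have [q [uE qE]] := skewpoly_split u.
  rewrite u00 rmorph0 add0r in uE; have Jq : J q by apply: Jsat; rewrite -uE.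
  have [q0|q_neq0] := pselect (q = 0); first by rewrite uE q0 mul0r.
  case: m um m_min {u0_bound} => [|m'] um m_min.
    by case: q_neq0; apply: scoefP => i; rewrite qE um // scoef0.
  suff /m_min : P m' by rewrite ltnn.
  by exists q; split=> // i lt_i; rewrite qE um.
pose Q n := exists u : skewpoly sh, [/\ J u, u <> 0, xdeg m u
  & forall j, (n < j)%N -> scoef (scoef u 0) j = 0].
have [|k [[u1 [Ju1 u1_neq0 u1m u1_bound]] k_min]] := @nat_least Q.
  have [f0|/scoef_top[n [_ f_bound]]] := pselect (scoef u0 0 = 0).
    by case: u0_neq0; apply: const_neq0.
  by exists n, u0.
have uniq u : J u -> xdeg m u -> (forall j, (k <= j)%N -> scoef (scoef u 0) j = 0) -> u = 0.
  move=> Ju um u_bound; apply: contrapT => u_neq0.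
  case: k k_min u_bound {u1_bound} => [|k'] k_min u_bound.
    by apply/u_neq0/const_neq0 => //; apply: scoefP => j; rewrite u_bound ?scoef0.
  suff /k_min : Q k' by rewrite ltnn.
  by exists u.
pose L c := exists u : skewpoly sh, [/\ J u, xdeg m u,
  forall j, (k < j)%N -> scoef (scoef u 0) j = 0 & scoef (scoef u 0) k = c].
have sh_coef f j : (forall i, (k < i)%N -> scoef f i = 0) -> (k <= j)%N ->
    scoef (sh f) j = sigma (scoef f j) * r j.
  move=> f_bound le_kj.
  rewrite (scoef_sigma_h sigma_tau_rho sigma_tau_b b1_unit shC shX _ f_bound).
  congr (_ * _); rewrite /taylor.
  have [->|lt_kj] := eqVneq j k.
    rewrite big_ord_recr /= subnn mulr1 binn big1 ?add0r // => i _.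
    by rewrite bin_small.
  have {}lt_kj : (k < j)%N by rewrite ltn_neqAle eq_sym lt_kj.
  rewrite f_bound // rmorph0 big1 // => i _; rewrite bin_small //.
  by rewrite (leq_ltn_trans _ lt_kj) // -ltnS.
have shJ u : J u -> xdeg m u -> exists v, [/\ J v, xdeg m v & forall i, scoef v i = sh (scoef u i)].
  move=> Ju um; have [v vE] := skew_map u (rmorph0 sh); exists v; split=> //.
    apply: Jsat; have -> : v * x = x * u; last exact: (JM _ _ Ju).1.
    by apply: scoefP => -[|i]; rewrite scoefMX scoefXM ?vE.
  by move=> i lt_i; rewrite vE um ?rmorph0.
have [u [Ju um f_bound fk]] : L 1.
  have Lsub c c' : L c -> L c' -> L (c - c').
    case=> [u [Ju um u_bound <-]] [v [Jv vm v_bound <-]]; exists (u - v); split.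
    - exact: JB.
    - by move=> i lt_i; rewrite scoefB um ?vm ?subrr.
    - by move=> j lt_j; rewrite !scoefB u_bound ?v_bound ?subrr.
    - by rewrite !scoefB.
  have Lr d c : L c -> L (c * d).
    case=> [u [Ju um u_bound <-]]; have [e <-] := iter_onto k nu_epi d.
    exists (u * CA (C e)); split; first exact: (JM _ _ Ju).2.
    - by move=> i lt_i; rewrite scoefMC um ?mul0r.
    - by move=> j lt_j; rewrite !scoefMC u_bound ?mul0r.
    - by rewrite !scoefMC.
  have [|c [v [Jv vm v_bound <-]]|L0|//] := simD (I := L).
  - split=> [||d c Lc]; first 1 last.
    + exact: Lsub.
    + split; last exact: Lr.
      case: Lc => [u [Ju um u_bound <-]].
      exists (CA (C d) * u); split; first exact: (JM _ _ Ju).1.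
      * by move=> i lt_i; rewrite scoefCM um ?mulr0.
      * by move=> j lt_j; rewrite !scoefCM u_bound ?mulr0.
      * by rewrite !scoefCM.
    + by exists 0; split=> // [i _|j _|]; rewrite !scoef0.
  - have [w [Jw wm wE]] := shJ v Jv vm.
    have [s [sr rs]] := rho_nu_unit sigma tau rhoVr rhorV k.
    rewrite -[sigma _]mulr1 -rs mulrA; apply: Lr.
    exists w; split=> // [j lt_j|]; rewrite wE sh_coef //; last exact: ltnW.
    by rewrite v_bound // rmorph0 mul0r.
  - case: u1_neq0; apply: uniq => // j; rewrite leq_eqVlt => /predU1P[<-|]; last exact: u1_bound.
    by apply: L0; exists u1.
set f := scoef u 0 in f_bound fk.
have JC d v : J v -> J (CA d * v) by move=> Jv; exact: (JM _ _ Jv).1.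
have uC d : u * CA (C d) = CA (C (iter k nu d)) * u.
  apply/eqP; rewrite -subr_eq0; apply/eqP/uniq.
  - by apply: JB; [exact: (JM _ _ Ju).2 | exact: JC].
  - by move=> i lt_i; rewrite scoefB scoefMC scoefCM um // mul0r mulr0 subrr.
  - move=> j; rewrite scoefB scoefMC scoefCM /= -/f scoefB scoefMC scoefCM.
    rewrite leq_eqVlt => /predU1P[<-|lt_j]; first by rewrite fk mul1r mulr1 subrr.
    by rewrite f_bound // mul0r mulr0 subrr.
have fC d : f * C d = C (iter k nu d) * f.
  by have /(congr1 (fun v => scoef v 0)) := uC d; rewrite scoefMC scoefCM.
have sh_f : sh f = C (r k) * f.
  have [v [Jv vm vE]] := shJ u Ju um.
  suff /(congr1 (fun v => scoef v 0)) : v = CA (C (r k)) * u by rewrite vE scoefCM.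
  apply/eqP; rewrite -subr_eq0; apply/eqP/uniq.
  - by apply: JB => //; exact: JC.
  - by move=> i lt_i; rewrite scoefB scoefCM vm // um // mulr0 subrr.
  - move=> j le_kj; rewrite scoefB vE scoefCM scoefB scoefCM sh_coef //.
    move: le_kj; rewrite leq_eqVlt => /predU1P[<-|lt_j].
      by rewrite fk rmorph1 mul1r mulr1 subrr.
    by rewrite f_bound // rmorph0 mul0r mulr0 subrr.
pose e := scoef (f * h - h * f) k.
have uX : u * CA h = CA (h + C e) * u.
  apply/eqP; rewrite -subr_eq0; apply/eqP/uniq.
  - by apply: JB; [exact: (JM _ _ Ju).2 | exact: JC].
  - by move=> i lt_i; rewrite scoefB scoefMC scoefCM um // mul0r mulr0 subrr.
  - move=> j; rewrite scoefB scoefMC scoefCM /= -/f mulrDl opprD addrA.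
    rewrite leq_eqVlt => /predU1P[<-|lt_j].
      by rewrite scoefB scoefCM fk mulr1 subrr.
    rewrite 2!scoefB scoefCM f_bound // mulr0 subr0 scoefMX scoefXM.
    case: j lt_j => // j; rewrite ltnS leq_eqVlt => /predU1P[<-|lt_j].
      by rewrite fk rmorph1 subrr.
    by rewrite f_bound // rmorph0 subrr.
have fX : f * h = (h + C e) * f.
  by have /(congr1 (fun v => scoef v 0)) := uX; rewrite scoefMC scoefCM.
have e0 : e = 0 := semi_invariant_commutes fk fC sh_f fX.
rewrite e0 rmorph0 addr0 in uX fX.
have k0 : k = 0%N by apply: (no_inv k f f_bound fk fC sh_f); rewrite fX.
have f1 : f = 1.
  apply: scoefP => -[|j]; rewrite scoef1; first by rewrite -[in LHS]k0 fk.
  by rewrite f_bound // k0.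
have m0 : m = 0%N.
  have [//|m_gt0] := posnP m.
  have u_top : scoef u m = 0.
    apply: (sigma_h_twist_eq0 m_gt0).
    by have /(congr1 (fun v => scoef v m)) := uX; rewrite scoefMC scoefCM.
  suff /m_min : P m.-1 by lia.
  exists u; split=> // [u0'|i lt_i].
    by move: fk; rewrite /f u0' !scoef0 => /esym/eqP; rewrite oner_eq0.
  by have [->//|i_neq] := eqVneq i m; apply: um; lia.
have <- : u = 1; last by [].
apply: scoefP => -[|i]; first by rewrite -/f f1 scoef1.
by rewrite um ?m0 // scoef1.
Qed.

End SaturatedIdeals.

(** * Ideals of the diskew polynomial ring *)

Section DiskewIdeals.
Variables (D : nzRingType) (sigma tau : {rmorphism D -> D}) (b rho rhoV : D).
Local Notation nu := (diskew_nu sigma tau).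
Local Notation r := (rho_nu sigma tau rho).
Local Notation DD := (skewpoly nu).
Local Notation C := (skewC nu).
Local Notation h := (skewX nu).
Local Notation E := (diskew sigma tau b rho).
Local Notation dk := (dsk sigma tau b rho).
Local Notation x := (diskewX sigma tau b rho).
Local Notation y := (diskewY sigma tau b rho).

Hypothesis sigma_tau_rho : forall d : D, sigma (tau d) * rho = rho * tau (sigma d).
Hypothesis sigma_tau_b : forall d : D, sigma (tau d) * b = b * d.
Hypothesis rhoVr : rhoV * rho = 1.
Hypothesis rhorV : rho * rhoV = 1.

Variables sh th : {rmorphism DD -> DD}.
Hypothesis shC : forall d, sh (C d) = C (sigma d).
Hypothesis shX : sh h = C rho * h + C b.
Hypothesis thC : forall d, th (C d) = C (tau d).
Hypothesis thX : th h = C (tau rhoV) * (h - C (tau b)).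

Variable gamma : {rmorphism DD -> E}.
Hypothesis gammaC : forall d, gamma (C d) = diskewC sigma tau b rho d.
Hypothesis gammaX : gamma h = y * x.

Lemma diskew_xy : x * y = gamma (sh h).
Proof.
rewrite shX rmorphD rmorphM !gammaC gammaX -(diskewXY sigma tau b rho).
by rewrite addrC subrK.
Qed.

Lemma diskew_x_comm u : x * gamma u = gamma (sh u) * x.
Proof.
apply: (@skew_intertwine D nu E gamma (gamma \o sh)) => [d|] /=.
  by rewrite shC !gammaC diskewXd.
by rewrite -diskew_xy gammaX mulrA.
Qed.

Lemma diskew_y_comm u : y * gamma u = gamma (th u) * y.
Proof.
apply: (@skew_intertwine D nu E gamma (gamma \o th)) => [d|] /=.
  by rewrite thC !gammaC diskewYd.
rewrite thX rmorphM rmorphB !gammaC gammaX -mulrA mulrBl -diskewYd -!mulrA -mulrBr.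
rewrite -(diskewXY sigma tau b rho) opprB addrCA subrr addr0 [in RHS](mulrA y) diskewYd.
by rewrite !mulrA -!rmorphM rhoVr !rmorph1 mul1r.
Qed.

Variable phi : {rmorphism skewpoly sh -> E}.
Hypothesis phiC : forall u, phi (skewC sh u) = gamma u.
Hypothesis phiX : phi (skewX sh) = x.
Variable psi : {rmorphism skewpoly th -> E}.
Hypothesis psiC : forall u, psi (skewC th u) = gamma u.
Hypothesis psiX : psi (skewX th) = y.

Lemma diskew_span u : exists a a', u = phi a + psi a'.
Proof.
pose N u := exists a a', u = phi a + psi a'.
have ND v w : N v -> N w -> N (v + w).
  case=> [a [a' ->]] [c [c' ->]]; exists (a + c), (a' + c').
  by rewrite !rmorphD addrACA.
have Nphi a : N (phi a) by exists a, 0; rewrite rmorph0 addr0.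
have Npsi a : N (psi a) by exists 0, a; rewrite rmorph0 add0r.
suff Nl s v : N v -> N (dk s * v).
  elim/dskW: u => s; rewrite -[dk s]mulr1; apply: Nl.
  by rewrite -(rmorph1 phi).
elim: s v => [d|||t IHt w IHw|t IHt|t IHt w IHw] v Nv.
- case: Nv => [a [a' ->]]; rewrite -[dk _]/(diskewC _ _ _ _ d) -gammaC mulrDr.
  by apply: (ND); [rewrite -phiC -rmorphM | rewrite -psiC -rmorphM].
- case: Nv => [a [a' ->]]; rewrite -[dk _]/x mulrDr; apply: (ND).
    by rewrite -phiX -rmorphM.
  have [n /skewpoly_expand->] := scoef_bound a'.
  rewrite rmorph_sum mulr_sumr; apply: (big_ind N _ ND) => [|[[|i] lt_i] _ /=].
    by rewrite -(rmorph0 phi).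
    by rewrite expr0 mulr1 psiC diskew_x_comm -phiC -phiX -rmorphM.
  rewrite exprS rmorphM psiC rmorphM rmorphXn psiX (mulrA x) diskew_x_comm -mulrA (mulrA x).
  by rewrite diskew_xy mulrA -rmorphM -psiC -psiX -rmorphXn -rmorphM.
- case: Nv => [a [a' ->]]; rewrite -[dk _]/y mulrDr; apply: (ND); last first.
    by rewrite -psiX -rmorphM.
  have [n /skewpoly_expand->] := scoef_bound a.
  rewrite rmorph_sum mulr_sumr; apply: (big_ind N _ ND) => [|[[|i] lt_i] _ /=].
    by rewrite -(rmorph0 phi).
    by rewrite expr0 mulr1 phiC diskew_y_comm -psiC -psiX -rmorphM.
  rewrite exprS rmorphM phiC rmorphM rmorphXn phiX (mulrA y) diskew_y_comm -mulrA (mulrA y).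
  by rewrite -gammaX mulrA -rmorphM -phiC -phiX -rmorphXn -rmorphM.
- by rewrite -dsk_addE -[dsk_add _ _]/(dk t + dk w) mulrDl; apply: (ND); auto.
- rewrite -dsk_oppE -[dsk_opp _]/(- dk t) mulNr -mulrN; apply: IHt.
  by case: Nv => [a [a' ->]]; exists (- a), (- a'); rewrite !rmorphN opprD.
- by rewrite -dsk_mulE -[dsk_mul _ _]/(dk t * dk w) -mulrA; apply/IHt/IHw.
Qed.

(** [tau^i(h)] has degree one in [h], with a unit leading coefficient. *)
Lemma tau_h_regular i w : w * iter i th h = 0 -> w = 0.
Proof.
have [e [c [v [-> ev]]]] : exists e c v, iter i th h = C e * h + C c /\ e * v = 1.
  elim: i => [|i [e [c [v [IHi ev]]]]] /=.
    by exists 1, 0, 1; rewrite rmorph1 rmorph0 mul1r addr0 mulr1.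
  exists (tau e * tau rhoV), (tau c - tau e * tau rhoV * tau b), (tau rho * tau v).
  split; last by rewrite -mulrA (mulrA (tau rhoV)) -!rmorphM rhoVr mul1r ev rmorph1.
  rewrite IHi rmorphD rmorphM !thC thX mulrBr mulrBr !mulrA -!rmorphM rmorphB.
  by rewrite addrA addrAC.
move=> wE; apply: contrapT => /scoef_top[n [w_n w_bound]]; apply: w_n.
have /(congr1 (fun g => scoef g n.+1)) := wE.
rewrite mulrDr mulrA scoefD scoefMX !scoefMC (w_bound n.+1) // mul0r addr0 scoef0.
move/(congr1 (fun d => d * iter n nu v)).
by rewrite -mulrA -skew_iterM ev skew_iter1 mulr1 mul0r.
Qed.

(** Multiplying on the right by [x] turns the [y]-part of an element into its
    [x]-part without loss, as [yx = h] is regular. *)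
Lemma diskew_ideal_meets (I : E -> Prop) : two_sided_ideal I ->
  (forall a, I (phi a) -> a = 0) -> forall u, I u -> u = 0.
Proof.
case=> [_ _ IM] I_phi.
have key n a a' : (forall i, (n <= i)%N -> scoef a' i = 0) ->
    I (phi a + psi (a' * skewX th)) -> a = 0 /\ a' = 0.
  elim: n a a' => [|n IHn] a a' a'_bound Iaa'.
    have a'0 : a' = 0 by apply: scoefP => i; rewrite a'_bound // scoef0.
    by move: Iaa'; rewrite a'0 mul0r rmorph0 addr0 => /I_phi.
  have [q [qE q_coef]] := skewpoly_split (a' * skewC th h).
  have [||aX0 q0] := IHn (a * skewX sh + skewC sh (scoef (a' * skewC th h) 0)) q.
  - by move=> i le_i; rewrite q_coef scoefMC a'_bound ?mul0r.
  - rewrite rmorphD phiC -addrA -psiC -rmorphD -qE !rmorphM phiX psiC gammaX mulrA -mulrDl.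
    have -> : psi a' * y = psi (a' * skewX th) by rewrite rmorphM psiX.
    exact: (IM _ _ Iaa').2.
  split; apply: scoefP => i; rewrite scoef0.
    have /(congr1 (fun g => scoef g i.+1)) := aX0.
    by rewrite scoefD scoefMX scoefC addr0 scoef0.
  apply: (@tau_h_regular i); case: i => [|i].
    have /(congr1 (fun g => scoef g 0)) := aX0.
    by rewrite scoefD scoefMX scoefC add0r scoef0 scoefMC.
  by have /(congr1 (fun g => scoef g i)) := q0; rewrite q_coef scoef0 scoefMC.
move=> u; have [a [a' ->]] := diskew_span u; have [q [-> _]] := skewpoly_split a'.
rewrite rmorphD addrA psiC -phiC -rmorphD; have [n q_bound] := scoef_bound q.
by move/(key n _ _ q_bound) => [-> ->]; rewrite mul0r !rmorph0 addr0.
Qed.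

Hypothesis b_unit : forall i, (1 <= i)%N -> is_unit (b_seq sigma b rho i).

(** [y x^s = h x^(s-1)] and [x^s y = sigma^s(h) x^(s-1)], while
    [sigma^s(h) = a_s h + b_s]. *)
Lemma diskew_ideal_xpow (I : E -> Prop) s : two_sided_ideal I -> I (x ^+ s) -> I 1.
Proof.
case=> [_ IB IM]; elim: s => [|s IHs] // Ixs; apply: IHs.
have x_iter u n : x ^+ n * gamma u = gamma (iter n sh u) * x ^+ n.
  elim: n u => [|n IHn] u; first by rewrite mul1r mulr1.
  by rewrite exprS -mulrA IHn mulrA diskew_x_comm -mulrA.
have Ih : I (gamma h * x ^+ s) by rewrite gammaX -mulrA -exprS; exact: (IM _ _ Ixs).1.
have := (IM y _ Ixs).2; rewrite exprSr -mulrA diskew_xy x_iter -iterSr.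
rewrite (sigma_h_iterE shC shX) // => Isx.
have [v [vb _]] := b_unit (ltn0Sn s).
have -> : x ^+ s = gamma (C v) * (gamma (C (a_seq sigma rho s.+1) * h +
    C (b_seq sigma b rho s.+1)) * x ^+ s - gamma (C (a_seq sigma rho s.+1)) * (gamma h * x ^+ s)).
  rewrite rmorphD mulrDl rmorphM !mulrA addrAC -mulrA subrr add0r mulrA -!rmorphM vb.
  by rewrite !rmorph1 mul1r.
apply: (IM _ _ _).1; apply: IB => //; exact: (IM _ _ Ih).1.
Qed.

Hypothesis nu_epi : forall d, exists d', nu d' = d.
Hypothesis simD : endo_simple sigma.
Hypothesis sh_onto : forall u, exists v, sh v = u.

(** The preimage [J] of an ideal of [E] in [D[h; nu][x; sigma]] is saturated by
    allowing right factors [x^s]; this keeps it two-sided because [sigma] is onto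
    on [D[h; nu]]. *)
Lemma simple_of_no_semi_invariant :
  (forall k beta, semi_invariant sigma tau b rho k beta -> beta k = 1 -> k = 0%N) ->
  simple_ring E.
Proof.
move=> no_inv; split=> [one0|I Iideal].
  have /eqP := diskewC_inj sigma_tau_rho sigma_tau_b one0.
  by rewrite oner_eq0.
have [I_phi|/existsNP[a /not_implyP[Ia a_neq0]]] := pselect (forall a, I (phi a) -> a = 0).
  by left; apply: diskew_ideal_meets.
right; have [I0 IB IM] := Iideal.
suff I1 : I 1 by move=> u; rewrite -[u]mulr1; exact: (IM _ _ I1).1.
pose J u := exists s, I (phi (u * skewX sh ^+ s)).
have phiXn s : phi (skewX sh ^+ s) = x ^+ s by rewrite rmorphXn phiX.
suff [s Is] : J 1 by apply: (diskew_ideal_xpow (s := s)) => //; rewrite -phiXn -[skewX _ ^+ _]mul1r.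
have b1_unit : is_unit b by rewrite -(b_seq1 sigma b rho); apply: b_unit.
apply: (@saturated_ideal_unit D sigma tau b rho rhoV) => //.
- move=> k f f_bound fk fC sh_f fX; apply: (no_inv k (scoef f)) => //.
  exact: (semi_invariant_poly sigma_tau_rho sigma_tau_b rhoVr rhorV b1_unit shC shX).
- have Jshift u s t : I (phi (u * skewX sh ^+ s)) -> I (phi (u * skewX sh ^+ (s + t))).
    by move=> Iu; rewrite exprD mulrA rmorphM; exact: (IM _ _ Iu).2.
  split=> [|u v [s Iu] [t Iv]|c u [s Iu]].
  + by exists 0%N; rewrite mul0r rmorph0.
  + exists (s + t)%N; rewrite mulrBl rmorphB; apply: IB; first exact: Jshift.
    by rewrite addnC; apply: Jshift.
  + split; exists s; first by rewrite -mulrA rmorphM; exact: (IM _ _ Iu).1.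
    (* move [c] to the left of [x^s] by lifting its coefficients along [sigma^s] *)
    suff [c' c'E] : exists c', c * skewX sh ^+ s = skewX sh ^+ s * c'.
      by rewrite -mulrA c'E mulrA rmorphM; exact: (IM _ _ Iu).2.
    elim: (s) c => [|t IHt] c; first by exists c; rewrite mul1r mulr1.
    have [c1 c1E] := IHt c; have [g gK] := choice sh_onto.
    have g0 : g 0 - g 0 = 0 by rewrite subrr.
    have [c2 c2E] := skew_map (f := fun u => g u - g 0) c1 g0.
    exists c2; rewrite exprSr mulrA c1E -!mulrA; congr (_ * _).
    apply: scoefP => -[|i]; rewrite scoefMX scoefXM // c2E rmorphB !gK.
    by rewrite subr0.
- by move=> u [s]; rewrite -mulrA -exprS; exists s.+1.
- by exists a; split=> //; exists 0%N; rewrite mulr1.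
Qed.

End DiskewIdeals.

Theorem theorem1p5 (p : nat) (p_prime : prime p) (D : algType 'F_p)
    (sigma tau : {rmorphism D -> D}) (b rho : D)
    (sigma_tau_rho : forall d : D, sigma (tau d) * rho = rho * tau (sigma d))
    (sigma_tau_b : forall d : D, sigma (tau d) * b = b * d)
    (rho_unit : is_unit rho)
    (nu_epi : forall d : D, exists d' : D, diskew_nu sigma tau d' = d) :
  let nu := diskew_nu sigma tau in
  let h := skewX nu in
  let C := skewC nu in
  let r := rho_nu sigma tau rho in
  [<-> simple_ring (diskew sigma tau b rho);

       [/\ bijective sigma /\ bijective tau,
           endo_simple sigma,
           forall n : nat,
             ~ exists (p' : skewpoly nu) (alpha_ : 'I_n -> D) (alpha : D),
                 [/\ p' = h ^+ (p ^ n) + \sum_(i < n) C (alpha_ i) * h ^+ (p ^ i)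
                          + C alpha,
                     forall d : D, p' * C d = C (iter (p ^ n) nu d) * p',
                     sigma_h sigma tau b rho p' = C (r (p ^ n)%N) * p'
                   & h * p' - p' * h = 0]
         & forall i : nat, (1 <= i)%N -> is_unit (b_seq sigma b rho i)];

       [/\ bijective sigma /\ bijective tau,
           endo_simple sigma,
           (~ exists alpha : D,
                [/\ rho * alpha - sigma alpha = b,
                    nu alpha = alpha
                  & forall d : D, alpha * d = nu d * alpha]) /\
           (forall n : nat, (1 <= n)%N ->
             ~ exists (alpha : D) (alpha_ : 'I_n -> D),
                 [/\ forall d : D,
                       alpha * d = iter (p ^ n) nu d * alpha /\
                       (forall i : 'I_n,
                          alpha_ i * d = iter (p ^ n - p ^ i) nu d * alpha_ i),
                     (forall i : 'I_n,
                        sigma (alpha_ i) = r (p ^ n - p ^ i)%N * alpha_ i) /\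
                     r (p ^ n)%N * alpha - sigma alpha =
                       b ^+ (p ^ n) + \sum_(i < n) sigma (alpha_ i) * b ^+ (p ^ i)
                   & nu alpha = alpha /\ (forall i : 'I_n, nu (alpha_ i) = alpha_ i)])
         & forall i : nat, (1 <= i)%N -> is_unit (b_seq sigma b rho i)]].
Proof.
move=> nu h C r; have [rhoV [rhoVr rhorV]] := rho_unit.
have pcharD : p \in [pchar D] by rewrite pchar_lalg pchar_Fp.
have [sh [shE shC' shX']] := sigma_hP sigma_tau_rho sigma_tau_b.
have shC d : sh (C d) = C (sigma d) by rewrite shE shC'.
have shX : sh h = C rho * h + C b by rewrite shE shX'.
have sigma_epi := sigma_onto sigma_tau_rho rhorV nu_epi.
tfae.
- move=> simE.
  have b_unit i (i_gt0 : (1 <= i)%N) : is_unit (b_seq sigma b rho i) :=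
    simple_b_unit sigma_tau_rho sigma_tau_b rhorV nu_epi simE i_gt0.
  have b1_unit : is_unit b by rewrite -(b_seq1 sigma b rho); apply: b_unit.
  have simD : endo_simple sigma := simple_endo_simple sigma_tau_rho sigma_tau_b simE.
  have sigma_bij := rmorph_bijective sigma_epi (sigma_inj simD).
  split=> //.
    split=> //; apply: rmorph_bijective; first exact: (tau_onto nu_epi).
    exact: (tau_inj sigma_tau_b b1_unit).
  move=> n [q [alpha_ [alpha [qE qC sh_q qX]]]].
  have pn_gt0 : (0 < p ^ n)%N by rewrite expn_gt0 prime_gt0.
  have le_pow (i : 'I_n) : (p ^ i < p ^ n)%N by rewrite ltn_exp2l // prime_gt1.
  have [v [vr _]] := rho_nu_unit sigma tau rhoVr rhorV (p ^ n).
  have q_coef k : (p ^ n <= k)%N -> scoef q k = (k == p ^ n)%N%:R.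
    move=> le_k; rewrite qE !scoefD scoefXn scoef_sum scoefC big1 => [|i _].
      by rewrite addr0 -[k == 0%N]negbK -lt0n (leq_trans pn_gt0) // addr0.
    by rewrite scoefCM scoefXn gtn_eqF ?mulr0 // (leq_trans (le_pow i)).
  apply: (simple_no_normal sigma_tau_rho sigma_tau_b rhoVr rhorV shC shX
    sigma_bij pn_gt0 _ _ qC _ _ vr simE).
  + by rewrite q_coef // eqxx.
  + by move=> k lt_k; rewrite q_coef ?gtn_eqF // ltnW.
  + by apply/eqP; rewrite -subr_eq0 qX.
  + by rewrite shE.
- case=> sigma_tau_bij simD no_q b_unit.
  have b1_unit : is_unit b by rewrite -(b_seq1 sigma b rho); apply: b_unit.
  have no_obstruction n alpha alpha_ :
      ~ @additive_obstruction D sigma tau b rho p n alpha alpha_.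
    move=> obs; apply: (no_q n).
    have [qC sh_q qX] := obstruction_normal sigma_tau_rho sigma_tau_b b1_unit
      shC shX p_prime pcharD obs.
    by do 3!eexists; split; [reflexivity | exact: qC | rewrite -shE sh_q | exact: qX].
  split=> //; split=> [[alpha [alpha_b alpha_nu alpha_comm]]|n _ [alpha [alpha_ obs]]].
    apply: (no_obstruction 0%N alpha (fun=> 0)); split.
    + by move=> d; split=> [|[]//]; rewrite alpha_comm.
    + by split=> [[]//|]; rewrite big_ord0 addr0 rho_nu1.
    + by split=> // -[].
  exact: (no_obstruction n alpha alpha_).
- case=> -[sigma_bij tau_bij] simD [no_alpha no_alpha_] b_unit.
  have b1_unit : is_unit b by rewrite -(b_seq1 sigma b rho); apply: b_unit.
  have [|th [thC thX]] := @lowering_exists D sigma tau b rho rhoV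
    sigma_tau_rho sigma_tau_b rhoVr rhorV tau; first by [].
  have [gamma [gammaC gammaX]] := skewpoly_diskew sigma tau b rho.
  have [|phi [_ phiC phiX]] := @skew_lift_exists _ sh _ gamma (diskewX sigma tau b rho).
    exact: (diskew_x_comm shC shX gammaC gammaX).
  have [|psi [_ psiC psiX]] := @skew_lift_exists _ th _ gamma (diskewY sigma tau b rho).
    exact: (diskew_y_comm rhoVr thC thX gammaC gammaX).
  have [sh' [_ sh'K]] := sigma_h_bijective sigma_tau_rho sigma_tau_b rhoVr rhorV shC shX sigma_bij.
  apply: (simple_of_no_semi_invariant sigma_tau_rho sigma_tau_b rhoVr rhorV
    shC shX thC thX gammaC gammaX phiC phiX psiC psiX b_unit nu_epi simD).
    by move=> u; exists (sh' u).
  move=> k beta beta_inv beta_k; apply: contrapT => /eqP; rewrite -lt0n => k_gt0.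
  have [|n [beta' [inv' top' supp']]] := semi_invariant_additive nu_epi simD
    p_prime pcharD (b := b) (rho := rho).
    by exists k; split=> //; exists beta.
  have := semi_invariant_obstruction p_prime pcharD inv' top' supp'.
  case: n {inv' top' supp'} => [|n] obs; last first.
    by apply: (no_alpha_ n.+1) => //; do 2!eexists; exact: obs.
  case: obs => a_comm [_ a_b] [a_nu _]; apply: no_alpha; exists (beta' 0%N); split=> //.
    by move: a_b; rewrite big_ord0 addr0 rho_nu1.
  by move=> d; rewrite (a_comm d).1.
Qed.
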